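(* Let $n\ge 1$ and $N\ge 0$ be integers and let $z=(z_1,\dots,z_n)$, $a=(a_1,\dots,a_n)$ and $b,c,d,e$ be nonzero complex parameters satisfying $$de=a_1\cdots a_n\,bc\,z_1\cdots z_n,$$ such that no denominator in the identity below vanishes. Then $$\sum_{\substack{y_1,\dots,y_n\geq 0\\ y_1+\dots+y_n=N}} \frac{\Delta(zq^y)}{\Delta(z)}\prod_{j,k=1}^n\frac{(a_jz_k)_{y_k}} {(qz_k/z_j)_{y_k}}\prod_{k=1}^n\frac{(bz_k)_{y_k}(cz_k)_{y_k}} {(dz_k)_{y_k}(ez_k)_{y_k}}$$ $$=\prod_{j=1}^n\frac{(a_jz_j)^N(d/a_j)_N(e/a_j)_N}{(dz_j)_N(ez_j)_N} \sum_{\substack{y_1,\dots,y_n\geq 0\\ y_1+\dots+y_n=N}} \frac{\Delta(aq^y)}{\Delta(a)}\prod_{j,k=1}^n\frac{(z_ja_k)_{y_k}} {(qa_k/a_j)_{y_k}}\prod_{k=1}^n\frac{(q^{1-N}a_kb/de)_{y_k} (q^{1-N}a_kc/de)_{y_k}}{(q^{1-N}a_k/d)_{y_k}(q^{1-N}a_k/e)_{y_k}},$$ where the summation indices $y_k$ are integers. Here $(a_jz_j)^N$ is an ordinary power.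
   Context: Fix complex numbers $p$ with $|p|<1$ and $q\neq 0$. The theta function is $\theta(x)=\prod_{j=0}^\infty(1-p^jx)(1-p^{j+1}/x)$ for $x\neq 0$. The elliptic Pochhammer symbol is $(u)_k=\theta(u)\theta(uq)\cdots\theta(uq^{k-1})$ for integers $k\ge 0$, with $(u)_0=1$. For a vector $z=(z_1,\dots,z_n)$ put $\Delta(z)=\prod_{1\le j<k\le n}z_j\,\theta(z_k/z_j)$ (equal to $1$ if $n=1$), and for $y=(y_1,\dots,y_n)$ let $zq^y=(z_1q^{y_1},\dots,z_nq^{y_n})$, so that $$\frac{\Delta(zq^y)}{\Delta(z)}=\prod_{1\le j<k\le n}q^{y_j}\frac{\theta(z_kq^{y_k}/z_jq^{y_j})}{\theta(z_k/z_j)}.$$ Notation such as $q^{1-N}a_kb/de$ means $q^{1-N}a_kb/(de)$. *)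

(* Defs.v *)
From HB Require Import structures.
From mathcomp Require Import all_boot all_order all_algebra.
From mathcomp Require Import all_classical all_reals all_analysis.
From mathcomp Require Import complex.
Import Order.TTheory GRing.Theory Num.Theory.
Import numFieldNormedType.Exports.

Set Implicit Arguments.
Unset Strict Implicit.
Unset Printing Implicit Defensive.

Local Open Scope ring_scope.

(* These definitions are meant for K = R[i] with R : realType, i.e. for the
   complex numbers.  There, for `|p| < 1 and x != 0, the partial products below
   converge; otherwise limn may be an unspecified default value. *)
Definition theta (K : numFieldType) (p x : K) : K :=
  limn (fun m : nat =>
    \prod_(0 <= j < m) ((1 - p ^+ j * x) * (1 - p ^+ j.+1 / x)) : K).

Definition epoch (K : numFieldType) (p q u : K) (k : nat) : K :=
  \prod_(0 <= i < k) theta p (u * q ^+ i).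

Definition Delta (K : numFieldType) (p : K) (n : nat) (z : 'I_n -> K) : K :=
  \prod_(j < n) \prod_(k < n | (j < k)%N) (z j * theta p (z k / z j)).

(* Nonnegative integer vectors of length n with sum N; their entries are at
   most N, so they are all represented by functions into 'I_N.+1. *)
Definition sums_to (n N : nat) (y : {ffun 'I_n -> 'I_N.+1}) : bool :=
  (\sum_(k < n) y k == N)%N.

(* Main.v *)
(** The sum on either side is, as a function of its parameters, determined by a
    recursion in N that keeps z and a fixed.  Writing S_N(b; d, e) for the left
    sum, the elliptic partial fraction identity
      sum_k prod_j theta(x_k/b_j) / prod_(j <> k) theta(x_k/x_j) = 0
      when prod_k x_k = prod_k b_k,
    taken at the points z_k q^(y_k) and 1/b, distributes each term of index y
    over its predecessors y - e_k; taken at z_k q^(y_k), 1/d and 1/e, it then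
    evaluates the sum over k and leaves one contribution for each of 1/d, 1/e:
      S_N(b; d, e) = C(d,e) S_(N-1)(qb; qd, e) + C(e,d) S_(N-1)(qb; d, qe).
    The parameters B = q^(1-N) b/(de), D = q^(1-N)/d, E = q^(1-N)/e of the right
    sum are permuted accordingly: (b, d) -> (qb, qd), N -> N-1 acts on them as
    (B, E) -> (qB, qE).  So both sides satisfy the same recursion.  It divides by
    theta(e/d), theta(b z_k q^m) and theta(B a_k q^m), which may vanish; this is
    repaired by continuity, replacing b, c, d, e by bt, c/t, dt, e/t, t -> 1.

    Partial fractions follow by induction from Weierstrass' addition formula.
    The latter is a Pluecker relation: theta(xy) theta(x/y)/x equals
    A(x) B(y) - B(x) A(y) up to a constant, with A(x) = sum_r p^(r(r+1)) x^(2r+1)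
    and B(x) = sum_r p^(r^2) x^(2r), as one sees on inserting Jacobi's triple
    product and summing the double series over k + l and k - l. *)

Require Import Defs.
From HB Require Import structures.
From mathcomp Require Import all_boot all_order all_algebra.
From mathcomp Require Import all_classical all_reals all_analysis.
From mathcomp Require Import complex.
From mathcomp Require Import ring lra zify.
Import Order.TTheory GRing.Theory Num.Theory.
Import numFieldNormedType.Exports.
Local Open Scope ring_scope.
Local Open Scope complex_scope.

(** * The modulus and completeness of [R[i]] *)

Section Limits.
Local Open Scope classical_set_scope.

Lemma num_cvg_unique (K : numFieldType) (T : Type) (F : set_system T)
    (FF : ProperFilter F) (u : T -> K) (l l' : K) :
  u x @[x --> F] --> l -> u x @[x --> F] --> l' -> l = l'.
Proof.
by move=> ul ul'; apply: (@cvg_unique K _ (u @ F)) => //; exact: norm_hausdorff.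
Qed.

End Limits.

Section Modulus.
Local Open Scope classical_set_scope.
Variable R : realType.
Implicit Types x y : R[i].
Local Notation N := (@Normc.normc R).
Local Notation C := (R[i] : numFieldType).

Lemma cmodE x : `|x| = (N x)%:C. Proof. by []. Qed.

Lemma cmod_ge0 x : 0 <= N x.
Proof. by case: x => a b; rewrite /= sqrtr_ge0. Qed.

Lemma cmodX x n : N (x ^+ n) = N x ^+ n.
Proof.
by elim: n => [|n IH]; rewrite ?expr0 ?Normc.normc1 // !exprS Normc.normcM IH.
Qed.

Lemma cmod_gt0 x : (0 < N x) = (x != 0).
Proof.
rewrite lt_def cmod_ge0 andbT; congr (~~ _); apply/eqP/eqP => [|->].
  exact: Normc.eq0_normc.
exact: Normc.normc0.
Qed.

Lemma cmodB x y : N (x - y) = N (y - x).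
Proof. by rewrite -normcN opprB. Qed.

Lemma ler_cmod_sum (I : Type) (r : seq I) (P : pred I) (F : I -> R[i]) :
  N (\sum_(i <- r | P i) F i) <= \sum_(i <- r | P i) N (F i).
Proof.
elim/big_rec2: _ => [|i y x _ le]; first by rewrite Normc.normc0.
by apply: le_trans (le_normcD _ _) _; rewrite lerD2l.
Qed.

Lemma cmod_Re x : `|complex.Re x| <= N x.
Proof.
case: x => a b /=; rewrite -sqrtr_sqr ler_sqrt ?lerDl ?sqr_ge0 //.
by rewrite addr_ge0 // sqr_ge0.
Qed.

Lemma cmod_Im x : `|complex.Im x| <= N x.
Proof.
case: x => a b /=; rewrite -sqrtr_sqr ler_sqrt ?lerDr ?sqr_ge0 //.
by rewrite addr_ge0 // sqr_ge0.
Qed.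

Lemma cmod_le_ReIm x : N x <= `|complex.Re x| + `|complex.Im x|.
Proof.
case: x => a b /=.
rewrite -[leRHS]ger0_norm ?addr_ge0 // -sqrtr_sqr ler_sqrt ?sqr_ge0 //.
by rewrite sqrrD !real_normK ?num_real // addrAC lerDl mulrn_wge0 // mulr_ge0.
Qed.

(** A positive element of [R[i]] has zero imaginary part, so the epsilons of its norm topology may
    be taken in [R]. *)
Lemma cvg_cmodP (T : Type) (F : set_system T) {FF : Filter F} (u : T -> C) (l : C) :
  (u x @[x --> F] --> l) <->
  (forall e : R, 0 < e -> \forall x \near F, N (l - u x) < e).
Proof.
split=> [/cvgrPdist_lt ul e e0|ul].
  have e0' : 0 < e%:C :> R[i] by rewrite ltcR.
  by have := ul _ e0'; apply: filterS => x; rewrite cmodE ltcR.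
apply/cvgrPdist_lt => e e0.
have eE : e = (complex.Re e)%:C.
  by rewrite RRe_real // realE (ltW e0).
have := ul (complex.Re e); rewrite -ltcR -eE => /(_ e0).
by apply: filterS => x; rewrite cmodE -ltcR -eE.
Qed.

(* [R[i]] carries no completeness instance, hence the passage through the real
   and imaginary parts. *)
Lemma cvg_geometric_cauchy (u : nat -> C) (c r : R) :
  0 <= r < 1 ->
  (forall m k, N (u (m + k)%N - u m) <= c * r ^+ m) ->
  exists2 l, u n @[n --> \oo] --> l & forall m, N (l - u m) <= c * r ^+ m.
Proof.
move=> /andP[r0 r1] ub.
have cr : c * r ^+ m @[m --> \oo] --> 0.
  by apply: cvg_geometric; rewrite ger0_norm.
(* To be used with [complex.Re] and [complex.Im]: both are additive and do not increase the modulus,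
   so they map [u] to real Cauchy sequences. *)
have real_part (f : R[i] -> R) : (forall x, `|f x| <= N x) ->
    {morph f : x y / x - y} -> cvg (f (u n) @[n --> \oo]).
  move=> fN fB; apply/cauchy_cvgP/cauchy_exP => e e0.
  move/cvgrPdist_lt: cr => /(_ e e0) [m _ hm].
  exists (f (u m)); exists m => // n /= mn.
  rewrite -(subnKC mn) -ball_normE /= -fB; apply: le_lt_trans (fN _) _.
  rewrite cmodB; apply: le_lt_trans (ub _ _) _; apply: le_lt_trans (hm m _) => //=.
  by rewrite sub0r normrN ler_norm.
have [a ha] : exists a : R, complex.Re (u n) @[n --> \oo] --> a.
  have fB : {morph (@complex.Re R) : x y / x - y} by case=> ? ? [].
  by have /cvg_ex := real_part _ cmod_Re fB.
have [b hb] : exists b : R, complex.Im (u n) @[n --> \oo] --> b.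
  have fB : {morph (@complex.Im R) : x y / x - y} by case=> ? ? [].
  by have /cvg_ex := real_part _ cmod_Im fB.
have ul : u n @[n --> \oo] --> (a +i* b : C).
  apply/cvg_cmodP => e e0.
  have e2 : 0 < e / 2 by rewrite divr_gt0.
  move/cvgrPdist_lt: ha => /(_ _ e2) ha; move/cvgrPdist_lt: hb => /(_ _ e2) hb.
  near=> n; apply: le_lt_trans (cmod_le_ReIm _) _; rewrite [e]splitr ltrD //.
    have : `|a - complex.Re (u n)| < e / 2 by near: n.
    by case: (u n).
  have : `|b - complex.Im (u n)| < e / 2 by near: n.
  by case: (u n).
(* The bound on [u (m + k) - u m] survives the limit: compare [l] with a late term, up to [e], and
   let [e] tend to 0. *)
exists (a +i* b : C) => // m; apply/ler_addgt0Pr => e e0.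
move/cvg_cmodP: ul => /(_ e e0) [n _ hn].
have /= := hn (m + n)%N (leq_addl _ _) => hl.
rewrite -(subrKA (u (m + n)%N)); apply: le_trans (le_normcD _ _) _.
by rewrite addrC lerD // ltW.
Unshelve. all: by end_near. Qed.

End Modulus.
Arguments cvg_cmodP {R T F FF u l}.

(** * Infinite products *)

Section InfiniteProduct.
Local Open Scope classical_set_scope.
Variable R : realType.
Local Notation N := (@Normc.normc R).
Local Notation C := (R[i] : numFieldType).

Lemma cmod_prod (I : Type) (s : seq I) (P : pred I) (F : I -> C) :
  N (\prod_(i <- s | P i) F i) = \prod_(i <- s | P i) N (F i).
Proof. exact: (big_morph _ (@Normc.normcM R) (@Normc.normc1 R)). Qed.

Lemma geometric_sum_le (r : R) k : 0 <= r < 1 ->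
  \sum_(0 <= j < k) r ^+ j <= (1 - r)^-1.
Proof.
move=> /andP[r0 r1]; rewrite -div1r ler_pdivlMr ?subr_gt0 // big_mkord.
have := subrX1 r k; have := exprn_ge0 k r0; nra.
Qed.

(** The exponents form a geometric series. The estimate serves for products of factors [1 + u j],
    for inverse q-factorials and for theta series. *)
Lemma prod_expR_le (f : nat -> R) (c r : R) m : 0 <= c -> 0 <= r < 1 ->
  (forall j, 0 <= f j <= expR (c * r ^+ j)) ->
  \prod_(0 <= j < m) f j <= expR (c / (1 - r)).
Proof.
move=> c0 r01 fE.
apply: (@le_trans _ _ (expR (c * \sum_(0 <= j < m) r ^+ j))); last first.
  by rewrite ler_expR ler_wpM2l // geometric_sum_le.
elim: m => [|m IH]; first by rewrite !big_nil mulr0 expR0.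
rewrite big_nat_recr //= [X in c * X]big_nat_recr //= mulrDr expRD.
have /andP[f0 fm] := fE m.
by apply: ler_pM => //; apply: prodr_ge0 => j _; have /andP[] := fE j.
Qed.

Section Bounds.
Variables (u : nat -> C) (c r : R).
Hypotheses (c0 : 0 <= c) (r01 : 0 <= r < 1).
Hypothesis hu : forall j, N (u j) <= c * r ^+ j.
Local Notation Q m := (\prod_(0 <= j < m) (1 + u j)).

Lemma cmod_prod_le m : N (Q m) <= expR (c / (1 - r)).
Proof.
rewrite cmod_prod; apply: prod_expR_le => // j; rewrite cmod_ge0 /=.
apply: le_trans (le_normcD _ _) _; rewrite Normc.normc1.
by apply: le_trans (expR_ge1Dx _); rewrite lerD2l.
Qed.

(** Consecutive partial products differ by [Q j * u j], at most a constant times [r ^+ j]; these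
    differences are summed from [m] on. *)
Lemma cmod_prodB_le m k :
  N (Q (m + k)%N - Q m) <= expR (c / (1 - r)) * c / (1 - r) * r ^+ m.
Proof.
have [r0 r1] := andP r01.
have E0 := expR_ge0 (c / (1 - r)).
have sum_bound : N (Q (m + k)%N - Q m) <=
    expR (c / (1 - r)) * c * r ^+ m * \sum_(0 <= j < k) r ^+ j.
  elim: k => [|k IH]; first by rewrite addn0 subrr big_nil mulr0 Normc.normc0.
  rewrite addnS big_nat_recr //= [X in _ <= _ * X]big_nat_recr //= [X in _ <= X]mulrDr mulrDr mulr1.
  rewrite addrAC; apply: le_trans (le_normcD _ _) _.
  apply: lerD => //; rewrite Normc.normcM -!mulrA -exprD.
  by apply: ler_pM; rewrite ?cmod_ge0 ?cmod_prod_le.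
apply: le_trans sum_bound _; rewrite [leRHS]mulrAC; apply: ler_wpM2l.
  by rewrite !mulr_ge0 // exprn_ge0.
exact: geometric_sum_le.
Qed.

Lemma infinite_prod_cvg :
  exists2 l : C, Q m @[m --> \oo] --> l &
    forall m, N (l - Q m) <= expR (c / (1 - r)) * c / (1 - r) * r ^+ m.
Proof. exact: cvg_geometric_cauchy r01 cmod_prodB_le. Qed.

End Bounds.

(* Only the factors beyond a rank that depends on [c] and [r] alone need to be
   close to [1], so the infinite product vanishes only if one of its first [s]
   factors does. *)
Lemma infinite_prod_neq0 (c r : R) : 0 <= c -> 0 <= r < 1 ->
  exists s : nat, forall (u : nat -> C) (l : C),
    (forall j, N (u j) <= c * r ^+ j) ->
    \prod_(0 <= j < m) (1 + u j) @[m --> \oo] --> l ->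
    \prod_(0 <= j < s) (1 + u j) != 0 -> l != 0.
Proof.
move=> c0 r01; have [r0 r1] := andP r01.
pose E := expR (c / (1 - r)) * c / (1 - r).
have E0 : 0 <= E by rewrite /E !mulr_ge0 ?expR_ge0 // invr_ge0 subr_ge0 ltW.
have : E * r ^+ m @[m --> \oo] --> 0 by apply: cvg_geometric; rewrite ger0_norm.
move=> /cvgrPdist_lt /(_ 1 ltr01)[s _ /(_ s)/= hs].
exists s => u l hu ul us.
have {}hs : E * r ^+ s < 1.
  by apply: le_lt_trans (hs (leqnn s)); rewrite sub0r normrN ler_norm.
have hv j : N (u (s + j)%N) <= c * r ^+ s * r ^+ j.
  by rewrite -mulrA -exprD.
have crs0 : 0 <= c * r ^+ s by rewrite mulr_ge0 ?exprn_ge0.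
have [l' vl' /(_ 0%N)] := infinite_prod_cvg _ _ _ crs0 r01 hv.
rewrite big_nil expr0 mulr1 => hl'.
(* [l'] is the limit of the tail product; its distance to the empty product 1 is at most
   [E * r ^+ s < 1]. *)
have l'0 : l' != 0.
  apply/eqP => l'0; move: hl'; rewrite l'0 sub0r normcN Normc.normc1; apply/negP.
  rewrite -ltNge; apply: le_lt_trans hs.
  have r_inv : 0 <= (1 - r)^-1 by rewrite invr_ge0 subr_ge0 ltW.
  rewrite /E -!mulrA [(1 - r)^-1 * _]mulrC ler_wpM2r //.
    by rewrite !mulr_ge0 // exprn_ge0.
  by rewrite ler_expR ler_wpM2l // ler_piMl // exprn_ile1 // ltW.
suff -> : l = \prod_(0 <= j < s) (1 + u j) * l' by rewrite mulf_neq0.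
have split_prod m : \prod_(0 <= j < (m + s)%N) (1 + u j) =
    \prod_(0 <= j < s) (1 + u j) * \prod_(0 <= j < m) (1 + u (s + j)%N).
  rewrite addnC (big_cat_nat _ (leq_addr m s)) //=; congr (_ * _).
  by rewrite -{1}[s]add0n big_addn addKn; under [RHS]eq_bigr do rewrite addnC.
apply: num_cvg_unique ul _; rewrite -(cvg_shiftn s) /=.
under eq_cvg do rewrite split_prod.
exact: cvgMl_tmp.
Qed.

End InfiniteProduct.

(** * Elementary properties of theta *)

Section ThetaProduct.
Local Open Scope classical_set_scope.
Variable R : realType.
Local Notation N := (@Normc.normc R).
Local Notation C := (R[i] : numFieldType).
Variable p : C.
Hypothesis hp : `|p| < 1.
Local Notation P m x :=
  (\prod_(0 <= j < m) ((1 - p ^+ j * x) * (1 - p ^+ j.+1 / x))).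

Lemma cmod_nome : 0 <= N p < 1.
Proof. by rewrite cmod_ge0 -ltcR; exact: hp. Qed.

(** A common bound [X] for [x] and its inverse confines a nonzero [x] to an annulus, on which all
    estimates are uniform. *)
Lemma theta_factor_bound (X : R) (x : C) j : N x <= X -> N x^-1 <= X ->
  N ((1 - p ^+ j * x) * (1 - p ^+ j.+1 / x) - 1) <= (X + X + 1) * N p ^+ j.
Proof.
move=> xX x'X; have [r0 r1] := andP cmod_nome.
have -> : (1 - p ^+ j * x) * (1 - p ^+ j.+1 / x) - 1 =
    (- (p ^+ j * x) - p ^+ j.+1 / x) + p ^+ j * p ^+ j.+1 * (x * x^-1).
  by ring.
have rj : N p ^+ j.+1 <= N p ^+ j by rewrite exprS ler_piMl ?exprn_ge0 ?(ltW r1).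
(* For [x = 0] the convention [0^-1 = 0] makes this product 0, so that [theta_cvg] covers that case
   too. *)
have xx : N (x * x^-1) <= 1.
  have [->|x0] := eqVneq x 0; first by rewrite mul0r Normc.normc0.
  by rewrite divff // Normc.normc1.
have rj0 : 0 <= N p ^+ j by rewrite exprn_ge0.
apply: le_trans (le_normcD _ _) _; rewrite mulrDl mul1r lerD //.
  apply: le_trans (le_normcD _ _) _; rewrite !normcN mulrDl !Normc.normcM !cmodX.
  by rewrite lerD // mulrC ler_pM ?cmod_ge0 ?exprn_ge0.
rewrite Normc.normcM; apply: le_trans (ler_piMr _ xx) _; rewrite ?cmod_ge0 //.
rewrite Normc.normcM !cmodX ler_piMr //.
by apply: exprn_ile1 => //; exact: ltW.
Qed.

(** [K] is chosen before [x]: convergence is uniform on the annulus, as the continuity of theta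
    requires. *)
Lemma theta_rate (X : R) : 0 <= X -> exists K : R, forall x,
  N x <= X -> N x^-1 <= X ->
  P m x @[m --> \oo] --> theta p x /\
  forall m, N (theta p x - P m x) <= K * N p ^+ m.
Proof.
move=> X0; have c0 : 0 <= X + X + 1 by rewrite !addr_ge0.
exists (expR ((X + X + 1) / (1 - N p)) * (X + X + 1) / (1 - N p)) => x xX x'X.
have PE m : P m x =
    \prod_(0 <= j < m) (1 + ((1 - p ^+ j * x) * (1 - p ^+ j.+1 / x) - 1)).
  by apply: eq_bigr => j _; rewrite [RHS]addrC subrK.
have [l Pl hl] := infinite_prod_cvg _ _ _ _ c0 cmod_nome
  (fun j => theta_factor_bound _ _ j xX x'X).
have {}Pl : P m x @[m --> \oo] --> l by under eq_cvg do rewrite PE.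
have -> : theta p x = l by apply: cvg_lim Pl; exact: norm_hausdorff.
by split=> // m; rewrite PE.
Qed.

Lemma theta_cvg x : P m x @[m --> \oo] --> theta p x.
Proof.
have [|K /(_ x)[]//] := theta_rate (N x + N x^-1).
- by rewrite addr_ge0 ?cmod_ge0.
- by rewrite lerDl cmod_ge0.
- by rewrite lerDr cmod_ge0.
Qed.

Lemma near_cmod_bound (x : C) : x != 0 -> exists2 X : R, 0 <= X &
  \forall y \near x, N y <= X /\ N y^-1 <= X.
Proof.
move=> x0; exists (N x + N x^-1 + (N x + N x^-1)).
  by rewrite !addr_ge0 ?cmod_ge0.
have e0 : 0 < N x + N x^-1 by rewrite addr_gt0 ?cmod_gt0 ?invr_eq0.
have xx : (fun y : C => y) y @[y --> x] --> x by exact: cvg_id.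
have xV : (fun y : C => y^-1) y @[y --> x] --> x^-1 by exact: inv_continuous.
have bound (a b : C) e : N (a - b) < e -> N b <= N a + e.
  move=> ab; have -> : N b = N (a + (b - a)) by rewrite addrC subrK.
  by apply: le_trans (le_normcD _ _) _; rewrite lerD2l cmodB ltW.
have h1 := cvg_cmodP.1 xx _ e0.
have h2 := cvg_cmodP.1 xV _ e0.
near=> y; split.
  have xy : N (x - y) < N x + N x^-1 by near: y; exact: h1.
  by apply: le_trans (bound _ _ _ xy) _; rewrite lerD2r lerDl cmod_ge0.
have xy : N (x^-1 - y^-1) < N x + N x^-1 by near: y; exact: h2.
by apply: le_trans (bound _ _ _ xy) _; rewrite lerD2r lerDr cmod_ge0.
Unshelve. all: by end_near. Qed.

Lemma theta_partial_continuous (x : C) m : x != 0 -> P m y @[y --> x] --> P m x.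
Proof.
move=> x0; apply: cvg_big => [||j _]; [exact: mul_continuous | exact: nbhs_filter |].
apply: (@cvgM C _ (nbhs x)).
  apply: cvgB; first exact: cvg_cst.
  by apply: cvgMl_tmp; exact: cvg_id.
apply: cvgB; first exact: cvg_cst.
by apply: cvgMl_tmp; exact: inv_continuous.
Qed.

(** A locally uniform limit of continuous partial products, by the three-epsilon argument. *)
Lemma theta_continuous (x : C) : x != 0 -> theta p y @[y --> x] --> theta p x.
Proof.
move=> x0; have [X X0 nearX] := near_cmod_bound _ x0.
have [K hK] := theta_rate X X0.
have [xX x'X] : N x <= X /\ N x^-1 <= X by exact: nbhs_singleton nearX.
suff small (e : R) : 0 < e -> \forall y \near x, N (theta p x - theta p y) < e.
  exact: (cvg_cmodP (FF := nbhs_filter x)).2 small.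
move=> e0; have e3 : 0 < e / 3 by rewrite divr_gt0.
have : K * N p ^+ m @[m --> \oo] --> 0.
  by apply: cvg_geometric; have [r0 r1] := andP cmod_nome; rewrite ger0_norm.
move=> /cvgrPdist_lt /(_ _ e3)[m _ /(_ m (leqnn m))/= hm].
have {}hm : K * N p ^+ m < e / 3.
  by apply: le_lt_trans hm; rewrite sub0r normrN ler_norm.
have hP := cvg_cmodP.1 (theta_partial_continuous _ m x0) _ e3.
near=> y.
have [yX y'X] : N y <= X /\ N y^-1 <= X by near: y.
have yP : N (P m x - P m y) < e / 3 by near: y; exact: hP.
have [_ /(_ m)/le_lt_trans/(_ hm) hx] := hK x xX x'X.
have [_ /(_ m)/le_lt_trans/(_ hm) hy] := hK y yX y'X.
have -> : theta p x - theta p y = (theta p x - P m x) + (P m x - P m y)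
    - (theta p y - P m y) by ring.
have := le_normcD (theta p x - P m x + (P m x - P m y)) (- (theta p y - P m y)).
have := le_normcD (theta p x - P m x) (P m x - P m y).
move: hx hy yP; rewrite normcN; lra.
Unshelve. all: by end_near. Qed.

Lemma near_neq (x a : C) : \forall y \near x^', y != a.
Proof.
have [->|xa] := eqVneq a x; first exact: nbhs_dnbhs_neq.
have xx : (fun y : C => y) y @[y --> x] --> x by exact: cvg_id.
have e0 : 0 < N (x - a) by rewrite cmod_gt0 subr_eq0 eq_sym.
apply: nbhs_dnbhs; apply: (@filterS _ _ (nbhs_filter x)) (cvg_cmodP.1 xx _ e0).
by move=> y; apply: contraTneq => ->; rewrite ltxx.
Qed.

(** Near [x] only the first [s] factors can vanish, with one [s] for a whole neighbourhood, and each
    has at most two zeros. So zeros are isolated, without any complex analysis. *)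
Lemma theta_neq0_near (x : C) : x != 0 -> \forall y \near x^', theta p y != 0.
Proof.
move=> x0; have [X X0 nearX] := near_cmod_bound _ x0.
have [s hs] := infinite_prod_neq0 _ (X + X + 1) (N p) (addr_ge0 (addr_ge0 X0 X0) ler01) cmod_nome.
have nearP : \forall y \near x^', P s y != 0.
  elim: s {hs} => [|s IH].
    by apply: nearW => y; rewrite big_nil oner_neq0.
  near=> y; rewrite big_nat_recr //= mulf_neq0 //; first by near: y.
  have y0 : y != 0 by near: y; exact: near_neq.
  apply: mulf_neq0; rewrite subr_eq0 eq_sym.
    have ys : y != (p ^+ s)^-1 by near: y; exact: near_neq.
    apply: contraNneq ys => ys; apply/eqP.
    have ps : p ^+ s != 0.
      by apply: contra_eq_neq ys => ->; rewrite mul0r eq_sym oner_neq0.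
    by apply: (mulfI ps); rewrite ys divff.
  have ys : y != p ^+ s.+1 by near: y; exact: near_neq.
  by apply: contraNneq ys => ys; rewrite -[p ^+ s.+1](divfK y0) ys mul1r.
near=> y.
have [yX y'X] : N y <= X /\ N y^-1 <= X by near: y; exact: nbhs_dnbhs.
have PE m : P m y =
    \prod_(0 <= j < m) (1 + ((1 - p ^+ j * y) * (1 - p ^+ j.+1 / y) - 1)).
  by apply: eq_bigr => j _; rewrite [RHS]addrC subrK.
apply: (hs _ _ (fun j => theta_factor_bound _ _ j yX y'X)).
  by under eq_cvg do rewrite -PE; exact: theta_cvg.
by rewrite -PE; near: y.
Unshelve. all: by end_near. Qed.

Lemma nomeX_cvg0 : p ^+ m @[m --> \oo] --> (0 : C).
Proof.
apply/cvg_cmodP => e e0; have [r0 r1] := andP cmod_nome.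
have : 1 * N p ^+ m @[m --> \oo] --> 0 by apply: cvg_geometric; rewrite ger0_norm.
move=> /cvgrPdist_lt /(_ _ e0); apply: filterS => m.
by rewrite !sub0r normrN normcN mul1r cmodX ger0_norm ?exprn_ge0.
Qed.

Lemma theta1 : theta p 1 = 0.
Proof.
apply: num_cvg_unique (theta_cvg 1) _.
rewrite -(cvg_shiftS _ (nbhs (0 : C))) /=.
under eq_cvg => m do rewrite big_nat_recl // expr0 mulr1 subrr !mul0r.
exact: (@cvg_cst C).
Qed.

(** Inversion exchanges the two families of factors up to a shift of the index, so only the boundary
    factors in [finite] remain. The case [x = 1] is separate because [1 - x] is cancelled at the
    end. *)
Lemma thetaV (x : C) : x != 0 -> theta p x^-1 = - theta p x / x.
Proof.
move=> x0; have [->|x1] := eqVneq x 1; first by rewrite invr1 theta1 oppr0 mul0r.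
have finite m : P m x^-1 * ((1 - x) * (1 - p ^+ m / x)) =
    P m x * ((1 - x^-1) * (1 - p ^+ m * x)).
  elim: m => [|m IH]; first by rewrite !big_nil !mul1r mulrC.
  rewrite !big_nat_recr //= invrK; move: IH; rewrite invrK => IH.
  transitivity (P m x * ((1 - x^-1) * (1 - p ^+ m * x)) *
    ((1 - p ^+ m.+1 * x) * (1 - p ^+ m.+1 / x))); last by ring.
  by rewrite -IH; ring.
have one (y : C) : (1 - p ^+ m * y) @[m --> \oo] --> (1 : C).
  rewrite -[X in _ --> X]subr0 -(mul0r y); apply: cvgB; first exact: cvg_cst.
  by apply: cvgMr_tmp; exact: nomeX_cvg0.
have xV : theta p x^-1 * ((1 - x) * 1) = theta p x * ((1 - x^-1) * 1).
  apply: (@num_cvg_unique C nat \oo _ (fun m => P m x^-1 * ((1 - x) * (1 - p ^+ m / x)))).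
    by apply: (@cvgM C); [exact: theta_cvg|apply: cvgMl_tmp; exact: one].
  under eq_cvg do rewrite finite.
  by apply: (@cvgM C); [exact: theta_cvg|apply: cvgMl_tmp; exact: one].
have x1' : 1 - x != 0 by rewrite subr_eq0 eq_sym.
by apply: (mulIf x1'); rewrite -[1 - x]mulr1 xV; field.
Qed.

End ThetaProduct.

(** * Jacobi's triple product *)

Section JacobiTripleProduct.

(** The exponent k(k-1)/2, valued in [nat] so that no negative power of [p] occurs, even when
    [p = 0]. *)
Definition tri (k : int) : nat :=
  match k with Posz n => 'C(n, 2) | Negz n => 'C(n.+2, 2) end.

Lemma triE (k : int) : (tri k)%:Z * 2 = k * (k - 1).
Proof.
have bin2E n : ('C(n, 2))%:Z * 2 = n%:Z * (n%:Z - 1).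
  by elim: n => // n IH; rewrite binS bin1; lia.
by case: k => n; rewrite /tri bin2E // NegzE; lia.
Qed.

Definition zrange m : seq int := [seq i%:Z - m%:Z | i <- iota 0 m.*2.+1].

Lemma mem_zrange m (k : int) : (k \in zrange m) = (`|k|%N <= m)%N.
Proof.
apply/mapP/idP => [[j]|km]; first by rewrite mem_iota => jm ->; lia.
by exists (absz (k + m%:Z)); rewrite ?mem_iota; lia.
Qed.

Lemma zrange_uniq m : uniq (zrange m).
Proof. by rewrite map_inj_uniq ?iota_uniq // => i j; lia. Qed.

Variable F : fieldType.
Implicit Types p x : F.

(** The symbol (p;p)_n; [qbin] is the Gaussian binomial coefficient built from it, and [theta_term]
    the general term of Jacobi's series. *)
Definition qfact p n := \prod_(0 <= j < n) (1 - p ^+ j.+1).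
Definition qbin p n i :=
  if (i <= n)%N then qfact p n / (qfact p i * qfact p (n - i)) else 0.
Definition theta_term p (k : int) x := (-1) ^+ `|k|%N * p ^+ tri k * x ^ k.

(** The alternating sign disappears at [- x]; for positive real [x] and nonnegative [p] all terms
    are then nonnegative, which [theta_series_bound] exploits. *)
Lemma theta_termN p k x : theta_term p k (- x) = p ^+ tri k * x ^ k.
Proof.
rewrite /theta_term mulrAC mulrC; congr (_ * _).
have sq n : (-1) ^+ n * (-1) ^+ n = 1 :> F by rewrite -expr2 sqrr_sign.
case: k => n; first by rewrite -!exprnP [(- x) ^+ _]exprNn mulrA sq mul1r.
rewrite NegzE -!exprnN [(- x) ^+ _]exprNn invfM mulrA abszN.
by rewrite -signr_odd invr_sign signr_odd sq mul1r.
Qed.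

Section QBinomial.
Variable p : F.
Hypothesis p_not_root : forall n, 1 - p ^+ n.+1 != 0.

Lemma qfact_neq0 n : qfact p n != 0.
Proof. by rewrite /qfact prodf_seq_neq0; apply/allP => j _; apply/implyP. Qed.

Lemma qfactS n : qfact p n.+1 = qfact p n * (1 - p ^+ n.+1).
Proof. by rewrite /qfact big_nat_recr. Qed.

Lemma qbin0 n : qbin p n 0 = 1.
Proof.
by rewrite /qbin subn0 {2}/qfact big_nil mul1r divff // qfact_neq0.
Qed.

Lemma qbin_small n i : (n < i)%N -> qbin p n i = 0.
Proof. by rewrite /qbin ltnNge => /negbTE ->. Qed.

Lemma qbin_pascal n i : (i <= n)%N ->
  qbin p n.+1 i.+1 = qbin p n i + p ^+ i.+1 * qbin p n i.+1.
Proof.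
rewrite /qbin ltnS => in_; rewrite in_ subSS.
case: ltnP => [lin|ni].
  have -> : (n - i = (n - i.+1).+1)%N by lia.
  have pn : p ^+ n.+1 = p ^+ i.+1 * p ^+ (n - i.+1).+1.
    by rewrite -exprD; congr (_ ^+ _); lia.
  rewrite !qfactS pn; field.
  by rewrite !qfact_neq0 !p_not_root.
have -> : i = n by lia.
by rewrite subnn mulr0 addr0 /qfact big_nil !mulr1 !divff // qfact_neq0.
Qed.

(** The mirror image of [qbin_pascal]. In [coef_jtp_poly] this rule handles the growth of [a], the
    other one the growth of [b]. *)
Lemma qbin_pascal' n i : (i <= n)%N ->
  qbin p n.+1 i.+1 = p ^+ (n - i) * qbin p n i + qbin p n i.+1.
Proof.
rewrite /qbin ltnS => in_; rewrite in_ subSS.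
case: ltnP => [lin|ni].
  have -> : (n - i = (n - i.+1).+1)%N by lia.
  have pn : p ^+ n.+1 = p ^+ i.+1 * p ^+ (n - i.+1).+1.
    by rewrite -exprD; congr (_ ^+ _); lia.
  rewrite !qfactS pn; field.
  by rewrite !qfact_neq0 !p_not_root.
have -> : i = n by lia.
by rewrite subnn mul1r addr0 /qfact big_nil !mulr1 !divff // qfact_neq0.
Qed.

(** The finite triple product multiplied by ['X ^+ b], which clears its negative powers. *)
Definition jtp_poly a b : {poly F} :=
  \prod_(0 <= j < a) (1 - (p ^+ j)%:P * 'X)
  * \prod_(0 <= j < b) ('X - (p ^+ j.+1)%:P).

(* The exponent of [p] is nonnegative even though [i - b] may be negative: this
   makes the induction work for [p = 0] too. *)
Lemma coef_jtp_poly a b i : (jtp_poly a b)`_i =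
  (-1) ^+ (i + b) * p ^+ tri (i%:Z - b%:Z) * qbin p (a + b) i.
Proof.
elim: b i => [|b IHb] i.
  elim: a i => [|a IHa] i.
    rewrite /jtp_poly !big_nil mulr1 coef1 addn0.
    by case: i => [|i]; rewrite ?qbin0 ?mulr1 //= mulr0.
  have -> : jtp_poly a.+1 0 = jtp_poly a 0 - (p ^+ a)%:P * (jtp_poly a 0 * 'X).
    by rewrite /jtp_poly big_nat_recr //= !big_nil; ring.
  rewrite coefB coefCM coefMX !IHa !addn0 !subr0.
  case: i => [|i]; first by rewrite /= !qbin0 mulr0 subr0.
  rewrite /=; have [ia|ia] := leqP i a; last first.
    by rewrite !qbin_small ?ltnS ?(ltnW ia) //; ring.
  rewrite qbin_pascal' //.
  have pE : p ^+ tri i.+1 * p ^+ (a - i) = p ^+ a * p ^+ tri i.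
    by rewrite -!exprD; congr (_ ^+ _); have := triE i.+1; have := triE i; lia.
  rewrite mulrDr [X in _ = X + _]mulrA -[X in _ = X * _ + _]mulrA pE exprS.
  by ring.
have -> : jtp_poly a b.+1 = jtp_poly a b * 'X - (p ^+ b.+1)%:P * jtp_poly a b.
  by rewrite /jtp_poly big_nat_recr //=; ring.
rewrite coefB coefCM coefMX !IHb !addnS.
have pS : p ^+ tri (i%:Z - b%:Z) * p ^+ b.+1 = p ^+ tri (i%:Z - b.+1%:Z) * p ^+ i.
  rewrite -!exprD; congr (_ ^+ _).
  by have := triE (i%:Z - b%:Z); have := triE (i%:Z - b.+1%:Z); lia.
case: i pS => [|i] pS.
  rewrite /= !qbin0 !add0n.
  transitivity (- ((-1) ^+ b * (p ^+ tri (0%:Z - b%:Z) * p ^+ b.+1))); first by ring.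
  by rewrite pS expr0 exprS; ring.
rewrite /=; have [ia|ia] := leqP i (a + b); last first.
  by rewrite !qbin_small ?ltnS ?(ltnW ia) //; ring.
rewrite qbin_pascal // !addSn.
transitivity ((-1) ^+ (i + b) * p ^+ tri (i%:Z - b%:Z) * qbin p (a + b) i +
  (-1) ^+ (i + b) * (p ^+ tri (i.+1%:Z - b%:Z) * p ^+ b.+1) * qbin p (a + b) i.+1).
  by rewrite !exprS; ring.
by rewrite pS subzSS !exprS; ring.
Qed.

(** Evaluate [jtp_poly m m] at [x] once as a product and once through its coefficients, then cancel
    [x ^+ m]. *)
Lemma finite_jtp m x : x != 0 ->
  \prod_(0 <= j < m) ((1 - p ^+ j * x) * (1 - p ^+ j.+1 / x)) =
  \sum_(k <- zrange m) qbin p m.*2 `|(k + m%:Z)%R|%N * theta_term p k x.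
Proof.
move=> x0; have xm : x ^+ m != 0 by rewrite expf_neq0.
have evalE : (jtp_poly m m).[x] =
    x ^+ m * \prod_(0 <= j < m) ((1 - p ^+ j * x) * (1 - p ^+ j.+1 / x)).
  rewrite /jtp_poly hornerM !horner_prod big_split /= mulrCA; congr (_ * _).
    by apply: eq_bigr => j _; rewrite !hornerE.
  have -> : x ^+ m = \prod_(0 <= j < m) x by rewrite prodr_const_nat subn0.
  rewrite -big_split /=; apply: eq_bigr => j _.
  by rewrite !hornerE mulrBr mulr1 mulrCA divff // mulr1.
apply: (mulfI xm); rewrite -evalE (@horner_coef_wide _ m.*2.+1); last first.
  apply/leq_sizeP => i im; rewrite coef_jtp_poly addnn qbin_small ?mulr0 //.
rewrite /zrange big_map mulr_sumr -[iota _ _]/(index_iota 0 m.*2.+1) big_mkord.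
apply: eq_bigr => i _; rewrite subrK coef_jtp_poly addnn /theta_term.
have -> : x ^ (i%:Z - m%:Z) = x ^+ i / x ^+ m by rewrite expfzDr // -invr_expz.
have -> : (-1) ^+ (i + m) = (-1) ^+ absz (i%:Z - m%:Z) :> F.
  by rewrite -signr_odd -[RHS]signr_odd; congr (_ ^+ nat_of_bool _); lia.
by field.
Qed.

End QBinomial.
End JacobiTripleProduct.

(** * Bounds and limits for q-binomial coefficients and theta series *)

Section ThetaSeriesBounds.
Local Open Scope classical_set_scope.
Variable R : realType.
Local Notation N := (@Normc.normc R).
Local Notation C := (R[i] : numFieldType).

(** For the lower bound the inverse factors are written 1 + t/(1-t), with t = r^(j+1), and bounded
    by exponentials. *)
Lemma qfact_bounds (r : R) : 0 <= r < 1 ->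
  exists2 k : R, 0 < k & forall n, k <= qfact _ r n <= 1.
Proof.
move=> r01; have /andP[r0 r1] := r01.
have s1 : 0 < 1 - r by rewrite subr_gt0.
have s0 : 0 <= (1 - r)^-1 by rewrite invr_ge0 ltW.
have rX j : 0 <= r ^+ j.+1 <= r.
  by rewrite exprn_ge0 //= exprS ler_piMr // exprn_ile1 // ltW.
exists (expR ((1 - r)^-1 / (1 - r)))^-1; first by rewrite invr_gt0 expR_gt0.
move=> n; apply/andP; split; last first.
  by apply: prodr_ile1 => j _; have := rX j; lra.
rewrite -[qfact _ r n]invrK lef_pV2 ?posrE ?expR_gt0 //; last first.
  by rewrite invr_gt0; apply: prodr_gt0 => j _; have := rX j; lra.
rewrite /qfact -prodfV; apply: prod_expR_le => // j.
have /andP[rj0 rj] := rX j.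
have t0 : 0 < 1 - r ^+ j.+1 by lra.
rewrite invr_ge0 (ltW t0) /=; apply: le_trans (expR_ge1Dx _).
have -> : (1 - r ^+ j.+1)^-1 = 1 + r ^+ j.+1 / (1 - r ^+ j.+1) by field; lra.
rewrite lerD2l mulrC; apply: ler_pM => //; first by rewrite invr_ge0 ltW.
  by rewrite lef_pV2 ?posrE // lerD2l lerN2.
by rewrite exprS ler_piMl ?exprn_ge0 // ltW.
Qed.

(** The finite triple product is read backwards at [- x]: all terms are nonnegative and every
    q-binomial is at least [kappa], so the series is at most the product divided by [kappa]. *)
Lemma theta_series_bound (r x : R) : 0 <= r < 1 -> 0 < x ->
  exists B : R, forall m, \sum_(k <- zrange m) r ^+ tri k * x ^ k <= B.
Proof.
move=> r01 x0; have [kappa k0 hk] := qfact_bounds _ r01.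
have /andP[r0 r1] := r01.
have r_not_root n : 1 - r ^+ n.+1 != 0.
  by rewrite subr_eq0 eq_sym lt_eqF // exprn_ilt1 // r0.
have qpos n : 0 < qfact _ r n by have /andP[] := hk n; move=> /(lt_le_trans k0).
have qbin_ge m (k : int) : k \in zrange m -> kappa <= qbin _ r m.*2 `|(k + m%:Z)%R|%N.
  rewrite mem_zrange /qbin => km; have -> : (absz (k + m%:Z)%R <= m.*2)%N by lia.
  have [/andP[h1 _] /andP[_ h2] /andP[_ h3]] :=
    And3 (hk m.*2) (hk (absz (k + m%:Z)%R)) (hk (m.*2 - absz (k + m%:Z)%R)%N).
  rewrite ler_pdivlMr ?mulr_gt0 //; apply: le_trans h1.
  by rewrite ler_piMr ?(ltW k0) // mulr_ile1 // ltW.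
exists (expR ((x + x^-1) / (1 - r)) / kappa) => m.
rewrite ler_pdivlMr //.
have xN0 : - x != 0 by rewrite oppr_eq0 gt_eqF.
apply: le_trans (_ : \prod_(0 <= j < m) ((1 - r ^+ j * - x) * (1 - r ^+ j.+1 / - x)) <= _).
  rewrite finite_jtp // mulr_suml big_seq [leRHS]big_seq.
  apply: ler_sum => k km.
  rewrite theta_termN mulrC ler_wpM2r ?qbin_ge // mulr_ge0 ?exprn_ge0 //.
  by rewrite exprz_ge0 // ltW.
apply: prod_expR_le => // [|j]; first by rewrite addr_ge0 ?invr_ge0 ?ltW.
have xV0 : 0 < x^-1 by rewrite invr_gt0.
have rj0 : 0 <= r ^+ j by rewrite exprn_ge0.
have rj : r ^+ j.+1 <= r ^+ j by rewrite exprS ler_piMl // ltW.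
have rjS : 0 <= r ^+ j.+1 by rewrite exprn_ge0.
have pos1 : 0 <= r ^+ j * x by rewrite mulr_ge0 // ltW.
have pos2 : 0 <= r ^+ j.+1 / x by rewrite mulr_ge0 // ltW.
rewrite invrN !mulrN !opprK mulr_ge0 ?addr_ge0 //= [(x + x^-1) * _]mulrDl expRD.
apply: ler_pM; rewrite ?addr_ge0 // mulrC; apply: le_trans (expR_ge1Dx _).
  by rewrite mulrC.
by rewrite lerD2l ler_wpM2l // ltW.
Qed.

Variable p : C.
Hypothesis hp : `|p| < 1.

Lemma nome_not_root n : 1 - p ^+ n.+1 != 0.
Proof.
have /andP[r0 r1] := cmod_nome _ _ hp.
apply/eqP => /eqP; rewrite subr_eq0 => /eqP/(congr1 N).
rewrite Normc.normc1 cmodX => pn.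
by have := exprn_ilt1 n.+1 r0 r1; rewrite -pn ltxx.
Qed.

Lemma qfact_cvg : exists2 L : C, L != 0 & qfact _ p n @[n --> \oo] --> L.
Proof.
have r01 := cmod_nome _ _ hp; have /andP[r0 r1] := r01.
have u_bound j : N (- p ^+ j.+1) <= 1 * N p ^+ j.
  by rewrite normcN cmodX mul1r exprS ler_piMl ?exprn_ge0 // ltW.
have [L QL _] := infinite_prod_cvg _ _ _ _ ler01 r01 u_bound.
exists L => //; have [s hs] := infinite_prod_neq0 _ _ _ ler01 r01.
by apply: hs u_bound QL _; exact: (qfact_neq0 _ _ nome_not_root).
Qed.

(** Supplies the dominating constant for [tannery]. The modulus of (p;p)_n is bounded below by the
    same symbol at the real nome |p|. *)
Lemma qbin_bound : exists B : R, forall n i, N (qbin _ p n i) <= B.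
Proof.
have r01 := cmod_nome _ _ hp; have /andP[r0 r1] := r01.
have [kappa k0 hk] := qfact_bounds _ r01.
have lower n : kappa <= N (qfact _ p n).
  apply: le_trans (_ : qfact _ (N p) n <= _); first by have /andP[] := hk n.
  rewrite cmod_prod; apply: ler_prod => j _.
  rewrite subr_ge0 exprn_ile1 ?(ltW r1) //=.
  have := le_normcD (1 - p ^+ j.+1) (p ^+ j.+1).
  by rewrite subrK Normc.normc1 cmodX lerBlDr.
have u_bound j : N (- p ^+ j.+1) <= 1 * N p ^+ j.
  by rewrite normcN cmodX mul1r exprS ler_piMl ?exprn_ge0 // ltW.
have upper n := cmod_prod_le _ _ _ _ ler01 r01 u_bound n.
exists (expR (1 / (1 - N p)) / (kappa * kappa)) => n j; rewrite /qbin.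
case: ifP => _; last first.
  by rewrite Normc.normc0 divr_ge0 ?expR_ge0 // mulr_ge0 // ltW.
rewrite Normc.normcM Normc.normcV Normc.normcM.
apply: ler_pM; rewrite ?cmod_ge0 ?invr_ge0 ?mulr_ge0 ?cmod_ge0 //; first exact: upper.
have kn m : 0 < N (qfact _ p m) by exact: lt_le_trans (lower m).
by rewrite lef_pV2 ?posrE ?mulr_gt0 // ler_pM // ltW.
Qed.

(** The indices of all three q-factorials tend to infinity, whatever [k], so the quotient tends to
    L/(L L), the inverse of (p;p)_oo. *)
Lemma qbin_cvg : exists2 L : C, L != 0 & forall k : int,
  qbin _ p m.*2 `|(k + m%:Z)%R|%N @[m --> \oo] --> L.
Proof.
have [L L0 qL] := qfact_cvg; exists L^-1; first by rewrite invr_eq0.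
move=> k; have sub (f : nat -> nat) : (forall m, (m <= f m + `|k|)%N) ->
    qfact _ p (f m) @[m --> \oo] --> L.
  move=> fm; apply: cvg_comp qL => A [n _ nA]; exists (n + `|k|)%N => // m /= nm.
  by apply: nA => /=; have := fm m; lia.
have E : \forall m \near \oo, qfact _ p m.*2 /
    (qfact _ p `|(k + m%:Z)%R|%N * qfact _ p (m.*2 - `|(k + m%:Z)%R|)%N) =
    qbin _ p m.*2 `|(k + m%:Z)%R|%N.
  exists `|k|%N => // m /= km; rewrite /qbin.
  by have -> : (absz (k + m%:Z)%R <= m.*2)%N by lia.
apply: cvg_trans (near_eq_cvg E) _.
rewrite -[L^-1]mul1r -(divff L0) -mulrA -invfM.
apply: (@cvgM C); first by apply: sub => m; lia.
apply: (@cvgV C); first by rewrite mulf_neq0.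
by apply: (@cvgM C); apply: sub => m; lia.
Qed.

End ThetaSeriesBounds.

(** * Jacobi's triple product as a limit of the finite one *)

Lemma sum_sub_split (T : eqType) (V : nmodType) (s t : seq T) (f : T -> V) :
  uniq s -> uniq t -> {subset s <= t} ->
  \sum_(i <- t) f i = \sum_(i <- s) f i + \sum_(i <- t | i \notin s) f i.
Proof.
move=> us ut st; rewrite (bigID (mem s)) /=; congr (_ + _).
rewrite -big_filter; apply: perm_big; apply: uniq_perm; rewrite ?filter_uniq //.
by move=> i; rewrite mem_filter; case: (boolP (i \in s)) => // /st ->.
Qed.

Section ThetaSeries.
Local Open Scope classical_set_scope.
Variable R : realType.
Local Notation N := (@Normc.normc R).
Local Notation C := (R[i] : numFieldType).

Lemma zrange_sub m n : (m <= n)%N -> {subset zrange m <= zrange n}.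
Proof. by move=> mn k; rewrite !mem_zrange => /leq_trans; apply. Qed.

Lemma bilateral_cvg (W : int -> R) (B : R) : (forall k, 0 <= W k) ->
  (forall m, \sum_(k <- zrange m) W k <= B) ->
  cvgn (fun m => \sum_(k <- zrange m) W k).
Proof.
move=> W0 WB; apply: nondecreasing_is_cvgn; last first.
  by exists B => _ [m _ <-].
move=> m n mn; rewrite (sum_sub_split _ _ _ _ _ (zrange_uniq m) (zrange_uniq n)).
  by rewrite lerDl sumr_ge0.
exact: zrange_sub.
Qed.

(** Dominated convergence for series: a finite head converges termwise and the tail is uniformly
    small. Stated for a difference, it does not presuppose that the series of [W] converges in
    [R[i]]. *)
Lemma tannery (g : nat -> int -> C) (W : int -> C) (L : C) (A B : R) :
  (forall m k, N (g m k) <= A) -> (forall k, g m k @[m --> \oo] --> L) ->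
  (forall m, \sum_(k <- zrange m) N (W k) <= B) ->
  \sum_(k <- zrange m) g m k * W k - L * \sum_(k <- zrange m) W k
    @[m --> \oo] --> (0 : C).
Proof.
move=> gA gL WB; apply/cvg_cmodP => e e0.
have W0 k : 0 <= N (W k) by exact: cmod_ge0.
have A0 : 0 <= A by apply: le_trans (gA 0%N 0); exact: cmod_ge0.
(* Bounds [L - g m k] in modulus; the summand 1 makes it positive. *)
pose D := A + N L + 1.
have D0 : 0 < D by rewrite ltr_wpDl ?addr_ge0 ?cmod_ge0.
have [l Wl] : exists l : R, \sum_(k <- zrange m) N (W k) @[m --> \oo] --> l.
  by apply/cvg_ex; exact: bilateral_cvg W0 WB.
(* The partial sums at [M] and at [m] are both this close to [l], so the tail between them is below
   [e / 2 / D]. *)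
have e4 : 0 < e / 4 / D by rewrite !divr_gt0.
have /cvgrPdist_lt /(_ _ e4) [M _ hM] := Wl.
have head : \sum_(k <- zrange M) N (L - g m k) * N (W k) @[m --> \oo] --> (0 : R).
  rewrite [X in _ --> X](_ : _ = \sum_(k <- zrange M) 0 * N (W k)); last first.
    by rewrite big1 // => k _; rewrite mul0r.
  apply: (@cvg_big R int _ _ _ add_continuous) => k _.
  apply: (@cvgMr_tmp R); apply/cvgrPdist_lt => e' e'0.
  have [n _ hn] := cvg_cmodP.1 (gL k) _ e'0; exists n => // m nm /=; have := hn m nm.
  by rewrite sub0r normrN ger0_norm ?cmod_ge0.
have e2 : 0 < e / 2 by rewrite divr_gt0.
have /cvgrPdist_lt /(_ _ e2) [M' _ hM'] := head.
exists (maxn M M') => // m /= mM.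
have Mm : (M <= m)%N by exact: leq_trans (leq_maxl _ _) mM.
have M'm : (M' <= m)%N by exact: leq_trans (leq_maxr _ _) mM.
rewrite sub0r normcN mulr_sumr -sumrB.
have -> : \sum_(k <- zrange m) (g m k * W k - L * W k) =
    \sum_(k <- zrange m) - ((L - g m k) * W k).
  by apply: eq_bigr => k _; ring.
apply: le_lt_trans (ler_cmod_sum _ _ _ _ _) _.
under eq_bigr do rewrite normcN Normc.normcM.
rewrite (sum_sub_split _ _ _ _ _ (zrange_uniq M) (zrange_uniq m) (zrange_sub _ _ Mm)).
have tail : \sum_(k <- zrange m | k \notin zrange M) N (W k) < e / 2 / D.
  have := sum_sub_split _ _ _ _ (fun k => N (W k)) (zrange_uniq M) (zrange_uniq m)
    (zrange_sub _ _ Mm).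
  have := hM M (leqnn M); have := hM m Mm => /=.
  rewrite !ltr_distlC; have -> : e / 2 / D = e / 4 / D + e / 4 / D by field; lra.
  lra.
rewrite [e]splitr; apply: ltr_leD.
  have := hM' m M'm => /=; rewrite sub0r normrN; apply: le_lt_trans.
  exact: ler_norm.
apply: le_trans (_ : D * (e / 2 / D) <= _); last by rewrite mulrC divfK ?gt_eqF.
apply: le_trans (_ : D * \sum_(k <- zrange m | k \notin zrange M) N (W k) <= _).
  rewrite mulr_sumr; apply: ler_sum => k _; rewrite ler_wpM2r //.
  apply: le_trans (le_normcD _ _) _; rewrite normcN /D.
  by have := gA m k; lra.
by rewrite ler_wpM2l // ltW.
Qed.

Lemma cmodXz (x : C) (k : int) : N (x ^ k) = N x ^ k.
Proof. by case: k => n; rewrite ?NegzE -?exprnN ?Normc.normcV cmodX. Qed.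

Variable p : C.
Hypothesis hp : `|p| < 1.
Local Notation w := (theta_term _ p).

Lemma cmod_theta_term k (x : C) : N (w k x) = N p ^+ tri k * N x ^ k.
Proof.
by rewrite /theta_term !Normc.normcM !cmodX cmodXz normcN Normc.normc1 expr1n mul1r.
Qed.

Lemma cmod_theta_series_bound (x : C) : x != 0 ->
  exists B : R, forall m, \sum_(k <- zrange m) N (w k x) <= B.
Proof.
move=> x0; have Nx : 0 < N x by rewrite cmod_gt0.
have [B hB] := theta_series_bound _ _ _ (cmod_nome _ _ hp) Nx.
by exists B => m; under eq_bigr do rewrite cmod_theta_term; exact: hB.
Qed.

(** The limit of [finite_jtp] taken under the sum; [L] is the inverse of (p;p)_oo. *)
Lemma theta_series : exists2 L : C, L != 0 & forall x : C, x != 0 ->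
  L * \sum_(k <- zrange m) w k x @[m --> \oo] --> theta p x.
Proof.
have [L L0 qL] := qbin_cvg _ _ hp; have [A hA] := qbin_bound _ _ hp.
exists L => // x x0; have [B hB] := cmod_theta_series_bound _ x0.
have := tannery (fun m k => qbin _ p m.*2 `|(k + m%:Z)%R|%N) (w^~ x) _ _ _
  (fun m k => hA m.*2 _) qL hB.
move=> /(@cvgB C C _ \oo _ _ _ _ _ (theta_cvg _ _ hp x)).
rewrite subr0; apply: cvg_trans; apply: near_eq_cvg; near=> m.
by rewrite !fctE finite_jtp ?subKr //; exact: nome_not_root.
Unshelve. all: by end_near. Qed.

End ThetaSeries.

(** * The addition formula *)

Section ThetaAddition.
Local Open Scope classical_set_scope.
Local Instance oo_filter : Filter (\oo : set_system nat).
Proof. typeclasses eauto. Qed.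

Variable R : realType.
Local Notation N := (@Normc.normc R).
Local Notation C := (R[i] : numFieldType).

Definition zbox m : seq (int * int) := [seq (k, l) | k <- zrange m, l <- zrange m].

Lemma mem_zbox m (kl : int * int) :
  (kl \in zbox m) = (`|kl.1|%N <= m)%N && (`|kl.2|%N <= m)%N.
Proof.
apply/allpairsP/idP => [[[k l] [/= km lm ->]]|/andP[km lm]].
  by rewrite -!mem_zrange km.
by exists kl; rewrite !mem_zrange; split=> //; case: kl {km lm}.
Qed.

Lemma zbox_uniq m : uniq (zbox m).
Proof. by apply: allpairs_uniq => [||[? ?] [? ?]]; rewrite ?zrange_uniq. Qed.

Lemma sum_zbox (F : pzSemiRingType) m (f g : int -> F) :
  \sum_(kl <- zbox m) f kl.1 * g kl.2 =
  (\sum_(k <- zrange m) f k) * (\sum_(l <- zrange m) g l).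
Proof. by rewrite big_allpairs big_distrlr. Qed.

(* The pairs [(k, l)] with [k + l] even, respectively odd, in the coordinates
   [((k + l) / 2, (k - l) / 2)], rounded. *)
Definition parity_box m : seq (int * int) :=
  [seq (j + 1 + r, j + 1 - r) | j <- zrange m, r <- zrange m] ++
  [seq (j + r + 1, j - r) | j <- zrange m, r <- zrange m].

Lemma parity_box_uniq m : uniq (parity_box m).
Proof.
rewrite cat_uniq; apply/and3P; split.
- apply: allpairs_uniq; rewrite ?zrange_uniq // => -[j r] [j' r'] _ _ /= [] E1 E2.
  by congr (_, _); lia.
- apply/hasPn => kl /allpairsP [[j r] [_ _ ->]]; apply/negP.
  by move=> /allpairsP [[j' r'] [_ _ /= [] E1 E2]]; lia.
- apply: allpairs_uniq; rewrite ?zrange_uniq // => -[j r] [j' r'] _ _ /= [] E1 E2.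
  by congr (_, _); lia.
Qed.

(** Together with [zbox_sub_parity] this encloses [parity_box m.+1] between [zbox m] and
    [zbox m.*2.+3], so square and rotated truncations of the double series have the same limit. *)
Lemma parity_box_sub m : {subset parity_box m <= zbox m.*2.+1}.
Proof.
move=> kl; rewrite mem_cat mem_zbox => /orP[] /allpairsP [[j r] /=];
  rewrite !mem_zrange => -[jm rm ->] /=; lia.
Qed.

Lemma zbox_sub_parity m : {subset zbox m <= parity_box m.+1}.
Proof.
move=> [k l]; rewrite mem_zbox mem_cat => /andP[km lm]; apply/orP.
have {}km : (absz k <= m)%N := km; have {}lm : (absz l <= m)%N := lm.
have [/eqP e|/eqP o] : ((k + l) %% 2)%Z == 0 \/ ((k + l) %% 2)%Z == 1 by lia.
  left; apply/allpairsP; exists (((k + l) %/ 2)%Z - 1, ((k - l) %/ 2)%Z) => /=.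
  by rewrite !mem_zrange; split; try congr (_, _); lia.
right; apply/allpairsP; exists (((k + l - 1) %/ 2)%Z, ((k - l - 1) %/ 2)%Z) => /=.
by rewrite !mem_zrange; split; try congr (_, _); lia.
Qed.

Variable p : C.
Hypothesis hp : `|p| < 1.
Local Notation w := (theta_term _ p).

Definition even_theta m (x : C) : C :=
  \sum_(r <- zrange m) p ^+ absz (r * r) * x ^ (2 * r).
Definition odd_theta m (x : C) : C :=
  \sum_(r <- zrange m) p ^+ absz (r * (r + 1)) * x ^ (2 * r + 1).

Lemma theta_termM (k l : int) (x y : C) : x != 0 -> y != 0 ->
  w k (x * y) * w l (x / y) =
  (-1) ^+ absz (k + l) * p ^+ (tri k + tri l) * x ^ (k + l) * y ^ (k - l).
Proof.
move=> x0 y0; rewrite /theta_term !expfzMl exprz_inv !expfzDr // exprD.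
have -> : (-1) ^+ absz (k + l) = (-1) ^+ absz k * (-1) ^+ absz l :> C.
  by rewrite -exprD -signr_odd -[RHS]signr_odd; congr (_ ^+ nat_of_bool _); lia.
by ring.
Qed.

(** In the rotated coordinates the exponent separates, into j(j+1) + r^2 on even pairs and j^2 +
    r(r+1) on odd ones, so either part is a product of two simple sums. The sign of the odd part is
    -1. *)
Lemma sum_parity_box m (x y : C) : x != 0 -> y != 0 ->
  \sum_(kl <- parity_box m) w kl.1 (x * y) * w kl.2 (x / y) =
  x * (odd_theta m x * even_theta m y - even_theta m x * odd_theta m y).
Proof.
move=> x0 y0; rewrite big_cat !big_allpairs_dep /= mulrBr !big_distrlr /= !mulr_sumr -sumrN.
congr (_ + _); apply: eq_bigr => j _; rewrite mulr_sumr -?sumrN; apply: eq_bigr => r _.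
  rewrite theta_termM //.
  have -> : j + 1 + r + (j + 1 - r) = 2 * j + 1 + 1 by ring.
  have -> : j + 1 + r - (j + 1 - r) = 2 * r by ring.
  have -> : (tri (j + 1 + r)%R + tri (j + 1 - r)%R = absz (j * (j + 1))%R + absz (r * r)%R)%N.
    have j0 : 0 <= j * (j + 1) by nia.
    have r0 : 0 <= r * r by nia.
    by have := triE (j + 1 + r); have := triE (j + 1 - r); lia.
  rewrite -signr_odd (_ : odd _ = false); last by lia.
  by rewrite exprD [x ^ (_ + _ + 1)]expfzDr // expr1z; ring.
rewrite theta_termM //.
have -> : j + r + 1 + (j - r) = 2 * j + 1 by ring.
have -> : j + r + 1 - (j - r) = 2 * r + 1 by ring.
have -> : (tri (j + r + 1)%R + tri (j - r)%R = absz (j * j)%R + absz (r * (r + 1))%R)%N.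
  have j0 : 0 <= j * j by nia.
  have r0 : 0 <= r * (r + 1) by nia.
  by have := triE (j + r + 1); have := triE (j - r); lia.
rewrite -signr_odd (_ : odd _ = true); last by lia.
by rewrite exprD [x ^ (_ + 1)]expfzDr // expr1z; ring.
Qed.

(** The 2x2 minor formed by the vectors ([odd_theta], [even_theta]) at [x] and [y]; the index [m.+1]
    suits [zbox_sub_parity]. *)
Definition theta_wedge m (x y : C) : C :=
  odd_theta m.+1 x * even_theta m.+1 y - even_theta m.+1 x * odd_theta m.+1 y.

Lemma theta_wedge_cvg : exists2 L : C, L != 0 & forall x y : C, x != 0 -> y != 0 ->
  L * theta_wedge m x y @[m --> \oo] --> theta p (x * y) * theta p (x / y) / x.
Proof.
have [L L0 hL] := theta_series _ _ hp.
exists (L * L) => [|x y x0 y0]; first by rewrite mulf_neq0.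
have xy0 : x * y != 0 by rewrite mulf_neq0.
have x_y0 : x / y != 0 by rewrite mulf_neq0 ?invr_eq0.
have [B1 hB1] := cmod_theta_series_bound _ _ hp _ xy0.
have [B2 hB2] := cmod_theta_series_bound _ _ hp _ x_y0.
have N0 k t : 0 <= N (w k t) by exact: cmod_ge0.
have [l1 c1] : exists l : R, \sum_(k <- zrange m) N (w k (x * y)) @[m --> \oo] --> l.
  by apply/cvg_ex; apply: bilateral_cvg hB1.
have [l2 c2] : exists l : R, \sum_(k <- zrange m) N (w k (x / y)) @[m --> \oo] --> l.
  by apply/cvg_ex; apply: bilateral_cvg hB2.
pose M m := m.*2.+3.
have cM (V : topologicalType) (u : nat -> V) (F : set_system V) :
    u m @[m --> \oo] --> F -> u (M m) @[m --> \oo] --> F.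
  move=> uF; apply: cvg_comp uF => A [n _ nA]; exists n => // m /= nm.
  by apply: nA => /=; rewrite /M; lia.
(* The two truncations differ by terms outside [zbox m], hence by at most the absolute double sum
   over [zbox (M m)] minus that over [zbox m], which tends to 0. *)
have diff0 : (\sum_(k <- zrange (M m)) w k (x * y)) *
    (\sum_(k <- zrange (M m)) w k (x / y)) - x * theta_wedge m x y
    @[m --> \oo] --> (0 : C).
  apply/cvg_cmodP => e e0.
  have cc := @cvgM R nat \oo oo_filter _ _ _ _ c1 c2.
  have := @cvgB R R nat \oo oo_filter _ _ _ _ (cM _ _ _ cc) cc; rewrite subrr.
  move=> /cvgrPdist_lt /(_ _ e0)[n _ hn]; exists n => // m nm /=.
  have := hn m nm; rewrite /= !fctE !sub0r normrN normcN.
  move=> /(le_lt_trans (ler_norm _)); apply: le_lt_trans.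
  rewrite -[X in _ <= _ - X]/((\sum_(k <- zrange m) _) * (\sum_(k <- zrange m) _)).
  rewrite /theta_wedge -sum_parity_box // -!sum_zbox.
  have sub1 : {subset zbox m <= zbox (M m)}.
    by move=> kl; rewrite !mem_zbox /M; lia.
  rewrite (sum_sub_split _ _ _ _ _ (parity_box_uniq m.+1) (zbox_uniq (M m))); last first.
    by move=> kl /parity_box_sub.
  rewrite [X in N X]addrC addKr.
  rewrite [X in _ <= X - _](sum_sub_split _ _ _ _ _ (zbox_uniq m) (zbox_uniq (M m)) sub1).
  rewrite [leRHS]addrC addKr; apply: le_trans (ler_cmod_sum _ _ _ _ _) _.
  under eq_bigr do rewrite Normc.normcM.
  rewrite [leLHS]big_mkcond [leRHS]big_mkcond; apply: ler_sum => kl _.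
  case: ifPn => klP; last by case: ifP => _ //; rewrite mulr_ge0 ?cmod_ge0.
  by rewrite (contra (@zbox_sub_parity _ _) klP).
pose S1 m := \sum_(k <- zrange m) w k (x * y).
pose S2 m := \sum_(k <- zrange m) w k (x / y).
have lim : L * S1 (M m) * (L * S2 (M m)) -
    L * L * (S1 (M m) * S2 (M m) - x * theta_wedge m x y) @[m --> \oo] -->
    theta p (x * y) * theta p (x / y) - L * L * 0.
  apply: (@cvgB C C nat \oo oo_filter); last exact: (@cvgMl_tmp C nat \oo oo_filter).
  apply: (@cvgM C nat \oo oo_filter).
    exact: cM (hL _ xy0).
  exact: cM (hL _ x_y0).
have lim' : L * L * (x * theta_wedge m x y) @[m --> \oo] -->
    theta p (x * y) * theta p (x / y).
  move: lim; rewrite mulr0 subr0; apply: cvg_trans; apply: near_eq_cvg.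
  by near=> m; ring.
have -> : (fun m => L * L * theta_wedge m x y) =
    (fun m => L * L * (x * theta_wedge m x y) * x^-1).
  by apply: funext => m; field.
exact: (@cvgMr_tmp C nat \oo oo_filter).
Unshelve. all: by end_near. Qed.

Lemma theta_add (x y u v : C) : x != 0 -> y != 0 -> u != 0 -> v != 0 ->
  theta p (x * y) * theta p (x / y) * (theta p (u * v) * theta p (u / v))
  - theta p (x * v) * theta p (x / v) * (theta p (u * y) * theta p (u / y))
  = u / y * (theta p (y * v) * theta p (y / v) * (theta p (x * u) * theta p (x / u))).
Proof.
move=> x0 y0 u0 v0; have [L L0 h] := theta_wedge_cvg.
pose g (a b : C) : C := theta p (a * b) * theta p (a / b) / a.
have c2 a b a' b' : a != 0 -> b != 0 -> a' != 0 -> b' != 0 ->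
    L * theta_wedge m a b * (L * theta_wedge m a' b') @[m --> \oo] --> g a b * g a' b'.
  by move=> a0 b0 a'0 b'0; apply: (@cvgM C nat \oo oo_filter); exact: h.
(* The three-term relation between 2x2 minors of four plane vectors holds exactly for each [m] and
   passes to the limit. *)
have plucker : g x y * g u v - g x v * g u y = g x u * g y v.
  apply: num_cvg_unique (c2 x u y v x0 u0 y0 v0).
  have -> : (fun m => L * theta_wedge m x u * (L * theta_wedge m y v)) =
      (fun m => L * theta_wedge m x y * (L * theta_wedge m u v) -
                L * theta_wedge m x v * (L * theta_wedge m u y)).
    apply: funext => m; rewrite /theta_wedge.
    move: (odd_theta _ x) (even_theta _ x) (odd_theta _ y) (even_theta _ y)
      (odd_theta _ u) (even_theta _ u) (odd_theta _ v) (even_theta _ v).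
    by move=> *; ring.
  by apply: (@cvgB C C nat \oo oo_filter); exact: c2.
have E : x * u * (g x y * g u v - g x v * g u y) = x * u * (g x u * g y v).
  by rewrite plucker.
move: E; rewrite /g.
move: (theta p (x * y)) (theta p (x / y)) (theta p (u * v)) (theta p (u / v))
  (theta p (x * v)) (theta p (x / v)) (theta p (u * y)) (theta p (u / y))
  (theta p (y * v)) (theta p (y / v)) (theta p (x * u)) (theta p (x / u)).
move=> t1 t2 t3 t4 t5 t6 t7 t8 t9 t10 t11 t12 E.
transitivity (x * u * (t1 * t2 / x * (t3 * t4 / u) - t5 * t6 / x * (t7 * t8 / u))).
  by field; rewrite x0 u0.
by rewrite E; field; rewrite x0 y0.
Qed.

End ThetaAddition.

(** * Elliptic partial fractions *)

Section PartialFractions.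
Variables (F : fieldType) (th : F -> F).

(* [theta_laws_add] is Weierstrass' addition formula at [X / s, s / b, s / e,
   s / d] with [s ^ 2 = c], in which no square root is left. *)
Record theta_laws : Prop := ThetaLaws {
  theta_laws1 : th 1 = 0;
  theta_lawsV : forall x, x != 0 -> th x^-1 = - th x / x;
  theta_laws_add : forall X b c d e,
    X != 0 -> b != 0 -> c != 0 -> d != 0 -> e != 0 ->
    th (X / b) * th (X * b / c) * (th (c / (d * e)) * th (d / e)) =
    th (X / d) * th (X * d / c) * (th (c / (e * b)) * th (b / e)) +
    b / e * (th (c / (b * d)) * th (d / b)) * (th (X / e) * th (X * e / c));
  theta_laws_div0 : forall x y, x != 0 -> y != 0 ->
    th x = 0 -> th y = 0 -> th (x / y) = 0 }.

Hypothesis laws : theta_laws.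
Variables (I : finType) (x : I -> F).
Hypothesis x0 : forall i, x i != 0.
Implicit Type A : {set I}.

Lemma theta_divC a b : a != 0 -> b != 0 -> th (a / b) = - (a / b) * th (b / a).
Proof.
move=> a0 b0; rewrite -[a / b]invf_div (theta_lawsV laws) ?mulf_neq0 ?invr_eq0 //.
by field; rewrite a0.
Qed.

(** A numerator factor vanishing at [x k] kills the term of [k] and cancels the factor for [k] in
    the other denominators: the descent step of [partial_fractions]. *)
Lemma cauchy_sum_setD1 A k (h : I -> F) : k \in A ->
  (forall i, i \in A -> i != k -> th (x i / x k) != 0) ->
  \sum_(i in A) th (x i / x k) * h i / \prod_(j in A | j != i) th (x i / x j) =
  \sum_(i in A :\ k) h i / \prod_(j in A :\ k | j != i) th (x i / x j).
Proof.
move=> kA sep; rewrite (bigD1 k) //= divff // (theta_laws1 laws) !mul0r add0r.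
apply: eq_big => [i|i /andP[iA ik]]; first by rewrite !inE andbC.
rewrite (bigD1 k) /= ?kA 1?eq_sym // invfM mulrACA divff ?sep // mul1r.
congr (_ / _); apply: eq_bigl => j; rewrite !inE.
by case: (j \in A); case: (j == k); case: (j == i).
Qed.

(** Induction on the number of points. From three points on, the addition formula writes the factors
    for [b] and [b'] as a combination of two products, one vanishing at [x k] and one at [x l]; each
    part reduces to one point fewer. *)
Lemma partial_fractions A (bs : seq F) :
  size bs = #|A| -> all (fun b => b != 0) bs ->
  (forall i j, i \in A -> j \in A -> i != j -> th (x i / x j) != 0) ->
  \prod_(i in A) x i = \prod_(b <- bs) b ->
  \sum_(i in A) (\prod_(b <- bs) th (x i / b)) / \prod_(j in A | j != i) th (x i / x j)
    = 0.
Proof.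
have [n bsn] : exists n, size bs = n by exists (size bs).
elim: n A bs bsn => [|n IH] A bs bsn sA bs0 sep bal.
  by rewrite big1 // => i; have /esym/eqP := sA; rewrite bsn cards_eq0 => /eqP ->; rewrite inE.
case: bs => [//|b bs] in bsn sA bs0 bal *.
case: bs => [|b' bs] in bsn sA bs0 bal *.
  have /esym/eqP/cards1P [i Ai] := sA; move: bal; rewrite Ai big_set1 big_seq1 => xi.
  have b0 : b != 0 by case/andP: bs0.
  by rewrite big_set1 big_seq1 xi divff // (theta_laws1 laws) mul0r.
have /and3P[b0 b'0 bs0'] := bs0.
have c0 : b * b' != 0 by rewrite mulf_neq0.
have [k kA] : exists k, k \in A by apply/card_gt0P; rewrite -sA.
have [l lA lk] : exists2 l, l \in A & l != k.
  have : (0 < #|A :\ k|)%N by have := cardsD1 k A; rewrite kA -sA /=; lia.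
  by case/card_gt0P => l; rewrite !inE => /andP[? ?]; exists l.
case: bs => [|b'' bs] in bsn sA bs0 bs0' bal *.
  (* With two points, balancing gives [x l / b = b' / x k], and the two terms cancel by
     inversion. *)
  have AE : A = [set k; l].
    apply/esym/eqP; rewrite eqEcard -sA cards2 eq_sym lk /= andbT.
    by apply/fintype.subsetP => i; rewrite !inE => /orP[] /eqP ->.
  have kl : k != l by rewrite eq_sym.
  rewrite AE in bal *.
  rewrite big_setU1 ?inE //= big_set1 !big_cons !big_nil !mulr1 in bal.
  rewrite big_setU1 ?inE //= big_set1 !big_cons !big_nil !mulr1.
  rewrite (big_pred1 l) => [|i]; last first.
    by rewrite !inE; case: (eqVneq i k) => [->|_] /=; rewrite ?(negbTE kl) ?andbT.
  rewrite (big_pred1 k) => [|i]; last first.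
    by rewrite !inE; case: (eqVneq i l) => [->|_] /=; rewrite ?(negbTE lk) ?orbF ?andbT ?andbF.
  have lkE : x l = b * b' / x k by rewrite -bal mulrAC divff ?mul1r.
  have e1 : x l / b = b' / x k by rewrite lkE; field; rewrite b0 x0.
  have e2 : x l / b' = b / x k by rewrite lkE; field; rewrite b'0 x0.
  rewrite e1 e2 (theta_divC (x k) (x l)) // (theta_divC b') // (theta_divC b) //.
  have lk0 := sep _ _ lA kA lk; rewrite lkE; field.
  by rewrite -lkE lk0 oppr_eq0 mulf_neq0 ?x0 ?b0 ?b'0.
have [m mA /andP[mk ml]] : exists2 m, m \in A & (m != k) && (m != l).
  have : (0 < #|A :\ k :\ l|)%N.
    have := cardsD1 k A; have := cardsD1 l (A :\ k).
    by rewrite !inE kA lA lk -sA /=; lia.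
  by case/card_gt0P => m; rewrite !inE => /and3P[ml mk mA]; exists m; rewrite ?mk.
pose c := b * b'.
(* The addition formula must be divided by this theta value. If it vanished for both [l] and [m],
   then theta would vanish at [x m / x l], a quotient of two zeros, against separation. *)
have [{mA mk ml}l {lA lk} [lA lk cl0]] :
    exists l, [/\ l \in A, l != k & th (c / (x k * x l)) != 0].
  have [cl|cl] := eqVneq (th (c / (x k * x l))) 0; last by exists l.
  exists m; split=> //; apply/eqP => cm.
  have cn t : c / (x k * x t) != 0 by rewrite !(mulf_neq0, invr_neq0).
  have /eqP := theta_laws_div0 laws _ _ (cn l) (cn m) cl cm.
  have -> : c / (x k * x l) / (c / (x k * x m)) = x m / x l.
    by rewrite /c; field; rewrite !x0 b0 b'0.
  by rewrite (negbTE (sep _ _ mA lA ml)).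
have kl : k != l by rewrite eq_sym.
have M0 : th (c / (x k * x l)) * th (x k / x l) != 0 by rewrite mulf_neq0 ?sep.
apply: (mulIf M0); rewrite mul0r mulr_suml.
pose P := th (c / (x l * b)) * th (b / x l).
pose Q := b / x l * (th (c / (b * x k)) * th (x k / b)).
pose rest u := \prod_(t <- b'' :: bs) th (u / t).
have split_term i : i \in A ->
    (\prod_(t <- [:: b, b', b'' & bs]) th (x i / t)) /
      \prod_(j in A | j != i) th (x i / x j) * (th (c / (x k * x l)) * th (x k / x l)) =
    P * (th (x i / x k) * (th (x i / (c / x k)) * rest (x i)) /
      \prod_(j in A | j != i) th (x i / x j)) +
    Q * (th (x i / x l) * (th (x i / (c / x l)) * rest (x i)) /
      \prod_(j in A | j != i) th (x i / x j)).
  move=> iA; rewrite 2!big_cons -/(rest _).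
  have := theta_laws_add laws _ _ _ _ _ (x0 i) b0 c0 (x0 k) (x0 l).
  have -> : x i * b / (b * b') = x i / b' by field; rewrite b0 b'0.
  rewrite -/c => E.
  have cE u : u != 0 -> x i / (c / u) = x i * u / c by move=> u0; field; rewrite u0 c0.
  rewrite !cE // /P /Q.
  set D := (\prod_(j in A | _) _)^-1.
  transitivity (th (x i / b) * th (x i / b') * (th (c / (x k * x l)) * th (x k / x l)) *
    rest (x i) * D).
    by ring.
  by rewrite E; ring.
rewrite (eq_bigr _ split_term) big_split /= -!mulr_sumr.
(* The parameters [b] and [b'] are replaced by the single [c / x k'], which keeps the smaller sum
   balanced. *)
have vanish k' : k' \in A ->
    \sum_(i in A) (th (x i / x k') * (th (x i / (c / x k')) * rest (x i)) /
      \prod_(j in A | j != i) th (x i / x j)) = 0.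
  move=> k'A; rewrite cauchy_sum_setD1 //; last by move=> i iA ik; exact: sep.
  have cardA' : #|A :\ k'| = n by apply: succn_inj; rewrite -bsn sA (cardsD1 k' A) k'A.
  rewrite -[RHS](IH (A :\ k') [:: c / x k', b'' & bs]).
  - by apply: eq_bigr => i _; rewrite big_cons.
  - by move: bsn => /= [].
  - by rewrite cardA'; move: bsn => /= [].
  - by case/and3P: bs0 => _ _ bs0 /=; rewrite mulf_neq0 ?invr_eq0.
  - by move=> i j /setD1P[_ iA] /setD1P[_ jA]; exact: sep.
  - rewrite big_cons; apply: (mulfI (x0 k')).
    move: bal; rewrite (big_setD1 k') //= => ->; rewrite 2!big_cons.
    by rewrite /c; field.
by rewrite !vanish // !mulr0 addr0.
Qed.
End PartialFractions.

(** * Partial fractions with one or two extra poles *)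

Lemma big_option (R : Type) (idx : R) (op : Monoid.com_law idx) (I : finType)
    (P : pred (option I)) (F : option I -> R) :
  \big[op/idx]_(i | P i) F i =
  op (if P None then F None else idx) (\big[op/idx]_(i | P (Some i)) F (Some i)).
Proof.
rewrite big_mkcond (bigD1 None) //=; congr (op _ _).
rewrite [LHS](reindex_omap Some id) => [|[]//]; rewrite [RHS]big_mkcond.
by apply: eq_bigl => j; rewrite /= eqxx.
Qed.

Section PartialFractionsPoles.
Variables (F : fieldType) (th : F -> F).
Hypothesis laws : theta_laws F th.

Lemma partial_fractionsT (I : finType) (x : I -> F) (bs : seq F) :
  (forall i, x i != 0) -> all (fun b => b != 0) bs -> size bs = #|I| ->
  (forall i j, i != j -> th (x i / x j) != 0) ->
  \prod_i x i = \prod_(b <- bs) b ->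
  \sum_i (\prod_(b <- bs) th (x i / b)) / \prod_(j | j != i) th (x i / x j) = 0.
Proof.
move=> x0 bs0 sbs sep bal.
rewrite -[RHS](partial_fractions _ _ laws _ x x0 [set: I] bs) ?cardsT //.
- apply: eq_big => [i|i _]; first by rewrite inE.
  by congr (_ / _); apply: eq_bigl => j; rewrite inE.
- by move=> i j _ _; exact: sep.
- by rewrite -bal; apply: eq_bigl => i; rewrite inE.
Qed.

(** The pole [u] joins the points as the index [None], and its term is moved to the right-hand
    side. *)
Lemma partial_fractions1 (I : finType) (x : I -> F) (u : F) (bs : seq F) :
  (forall i, x i != 0) -> u != 0 -> all (fun b => b != 0) bs -> size bs = #|I|.+1 ->
  (forall i j, i != j -> th (x i / x j) != 0) -> (forall i, th (x i / u) != 0) ->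
  u * \prod_i x i = \prod_(b <- bs) b ->
  \sum_i (\prod_(b <- bs) th (x i / b)) /
      (th (x i / u) * \prod_(j | j != i) th (x i / x j)) =
  - ((\prod_(b <- bs) th (u / b)) / \prod_i th (u / x i)).
Proof.
move=> x0 u0 bs0 sbs sep sepu bal.
pose X (i : option I) := if i is Some i then x i else u.
have X0 i : X i != 0 by case: i => /=.
have sepX i j : i != j -> th (X i / X j) != 0.
  case: i j => [i|] [j|] //= ij; first exact: sep.
  by rewrite (theta_divC _ _ laws) // mulf_neq0 // oppr_eq0 mulf_neq0 ?invr_eq0.
have := partial_fractionsT _ X bs X0 bs0; rewrite card_option.
move=> /(_ sbs sepX); rewrite big_option => /(_ bal).
rewrite big_option /= addrC => /eqP; rewrite addr_eq0 => /eqP E.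
transitivity (\sum_i \prod_(b <- bs) th (x i / b) /
    \prod_(j | j != Some i) th (x i / X j)).
  by apply: eq_bigr => i _; rewrite big_option.
by rewrite E big_option /= mul1r.
Qed.

(** [v] is adjoined to the points in the same way, and then [partial_fractions1] is applied with
    pole [u]. *)
Lemma partial_fractions2 (I : finType) (x : I -> F) (u v : F) (bs : seq F) :
  (forall i, x i != 0) -> u != 0 -> v != 0 ->
  all (fun b => b != 0) bs -> size bs = #|I|.+2 ->
  (forall i j, i != j -> th (x i / x j) != 0) ->
  (forall i, th (x i / u) != 0) -> (forall i, th (x i / v) != 0) -> th (u / v) != 0 ->
  u * (v * \prod_i x i) = \prod_(b <- bs) b ->
  \sum_i (\prod_(b <- bs) th (x i / b)) /
      (th (x i / u) * th (x i / v) * \prod_(j | j != i) th (x i / x j)) =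
  - ((\prod_(b <- bs) th (u / b)) / (th (u / v) * \prod_i th (u / x i)))
  - ((\prod_(b <- bs) th (v / b)) / (th (v / u) * \prod_i th (v / x i))).
Proof.
move=> x0 u0 v0 bs0 sbs sep sepu sepv uv bal.
have vu : th (v / u) != 0.
  by rewrite (theta_divC _ _ laws) // mulf_neq0 // oppr_eq0 mulf_neq0 ?invr_eq0.
pose X (i : option I) := if i is Some i then x i else v.
have X0 i : X i != 0 by case: i => /=.
have sepX i j : i != j -> th (X i / X j) != 0.
  case: i j => [i|] [j|] //= ij; first exact: sep.
  by rewrite (theta_divC _ _ laws) // mulf_neq0 // oppr_eq0 mulf_neq0 ?invr_eq0.
have sepXu i : th (X i / u) != 0 by case: i.
have := partial_fractions1 _ X u bs X0 u0 bs0; rewrite card_option.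
move=> /(_ sbs sepX sepXu); rewrite big_option => /(_ bal).
rewrite !big_option /= => /(canRL (addKr _)) E.
transitivity (\sum_i (\prod_(b <- bs) th (x i / b)) /
    (th (x i / u) * \prod_(j | j != Some i) th (x i / X j))).
  by apply: eq_bigr => i _; rewrite big_option /= mulrA.
by rewrite E mul1r addrC.
Qed.

End PartialFractionsPoles.

Lemma absz_le_pred (i : int) N : (absz i <= N)%N -> (absz (i - 1)%R <= N.+1)%N.
Proof. lia. Qed.

Lemma absz_le_succ (i : int) N : (absz i <= N)%N -> (absz (i + 1)%R <= N.+1)%N.
Proof. lia. Qed.

(** * Raising one coordinate of the summation index *)

Definition incr n (y : 'I_n -> nat) (k : 'I_n) : 'I_n -> nat := fun j => (y j + (j == k))%N.
Arguments incr {n} y k.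

Section Increments.
Variables (K : numFieldType) (n M : nat).
Local Notation Y := {ffun 'I_n -> 'I_M.+1}.
Implicit Types (x z a : 'I_n -> K) (y : Y).

(** Raising the coordinate [k] is a bijection onto the vectors with [0 < y k]; [G] vanishes on the
    rest. As [N < M], raised entries still fit, and [inord] never takes its default value where it
    matters. *)
Lemma sum_incr (N : nat) (k : 'I_n) (G : ('I_n -> nat) -> K) : (N < M)%N ->
  (forall y, y k = 0%N :> nat -> G (fun j => y j) = 0) ->
  \sum_(y : Y | (\sum_j y j == N.+1)%N) G (fun j => y j) =
  \sum_(y : Y | (\sum_j y j == N)%N) G (incr (fun j => y j) k).
Proof.
move=> NM G0.
pose up y : {ffun 'I_n -> 'I_M.+1} := [ffun j => inord (y j + (j == k))].
pose down y : {ffun 'I_n -> 'I_M.+1} := [ffun j => inord (y j - (j == k))].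
have sum_split (f : 'I_n -> nat) : (\sum_j (f j + (j == k)) = (\sum_j f j).+1)%N.
  rewrite big_split /= -addn1; congr addn.
  by rewrite (bigD1 k) //= eqxx big1 // => j /negbTE ->.
have upE y (j : 'I_n) : (\sum_j y j = N)%N -> up y j = (y j + (j == k))%N :> nat.
  move=> yN; rewrite ffunE inordK //.
  have : (y j <= N)%N by rewrite -yN (bigD1 j) //= leq_addr.
  by case: (j == k); lia.
have downE y (j : 'I_n) : down y j = (y j - (j == k))%N :> nat.
  by rewrite ffunE inordK //; have := ltn_ord (y j); lia.
have upK y : (\sum_j y j = N)%N -> down (up y) = y.
  by move=> yN; apply/ffunP => j; apply: val_inj; rewrite /= downE upE // addnK.
have downK y : (0 < y k)%N -> up (down y) = y.
  move=> yk; apply/ffunP => j; apply: val_inj => /=.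
  have le : ((j == k) <= y j)%N by case: eqVneq => [->|].
  by rewrite ffunE downE subnK // inord_val.
rewrite (bigID (fun y => (0 < y k)%N)) /= [X in _ + X]big1 ?addr0; last first.
  by move=> y /andP[_]; rewrite -leqNgt leqn0 => /eqP; exact: G0.
rewrite (reindex_onto up down) /=; last by move=> y /andP[_]; exact: downK.
have predE y : ((\sum_j up y j == N.+1)%N && (0 < up y k)%N) && (down (up y) == y) =
    (\sum_j y j == N)%N.
  apply/idP/idP => [/andP[/andP[/eqP upN upk] /eqP yK]|/eqP yN].
    rewrite -eqSS -upN -sum_split; apply/eqP/eq_bigr => j _.
    have le : ((j == k) <= up y j)%N by case: eqVneq => [->|].
    by rewrite -[in LHS]yK downE subnK.
  rewrite upK // eqxx andbT; apply/andP; split; last by rewrite upE // eqxx addn1.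
  by rewrite -yN -sum_split; apply/eqP/eq_bigr => j _; rewrite upE.
apply: eq_big => y; first exact: predE.
by rewrite predE => /eqP yN; congr G; apply: funext => j; exact: upE.
Qed.
End Increments.

(** * The recursion in N *)

Section Multisum.
Variables (K : numFieldType) (p q : K).
Hypotheses (laws : theta_laws K (theta p)) (q0 : q != 0).
Local Notation th := (theta p).
Local Notation ep := (epoch p q).

Lemma epochSr u m : ep u m.+1 = ep u m * th (u * q ^+ m).
Proof. by rewrite /epoch big_nat_recr. Qed.

Lemma epochSl u m : ep u m.+1 = th u * ep (q * u) m.
Proof.
rewrite /epoch big_nat_recl // expr0 mulr1; congr (_ * _).
by apply: eq_bigr => j _; rewrite exprS mulrA [u * q]mulrC.
Qed.

Lemma epoch_shift u m : ep u m * th (u * q ^+ m) = th u * ep (q * u) m.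
Proof. by rewrite -epochSr epochSl. Qed.

Lemma epoch_neq0P u m :
  reflect (forall j, (j < m)%N -> th (u * q ^+ j) != 0) (ep u m != 0).
Proof.
rewrite /epoch prodf_seq_neq0; apply: (iffP allP) => h j.
  by move=> jm; apply: h; rewrite mem_index_iota.
by rewrite mem_index_iota; exact: h.
Qed.

Variable n : nat.
Implicit Types (x z a : 'I_n -> K) (b c d e : K) (y : 'I_n -> nat).

(** Only pairs containing [k] change. When [k] is the smaller index, both thetas are inverted, and
    the factor [x j] in [Delta] absorbs what inversion produces. *)
Lemma Delta_incr x (k : 'I_n) : (forall j, x j != 0) ->
  (forall i j, i != j -> th (x i / x j) != 0) ->
  Delta p (fun j => x j * q ^+ (j == k)) =
  Delta p x * \prod_(j < n | j != k) (th (q * x k / x j) / th (x k / x j)).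
Proof.
move=> x0 sep.
pose rho j := th (q * x k / x j) / th (x k / x j).
have pairE (j l : 'I_n) : (j < l)%N ->
    x j * q ^+ (j == k) * th (x l * q ^+ (l == k) / (x j * q ^+ (j == k))) =
    x j * th (x l / x j) * ((if l == k then rho j else 1) * (if j == k then rho l else 1)).
  move=> jl; have lj : l != j by rewrite -val_eqE /= gtn_eqF.
  case: (eqVneq l k) => [lk|lk]; case: (eqVneq j k) => [jk|jk].
  - by rewrite lk jk eqxx in lj.
  - rewrite expr0 expr1 !mulr1 /rho -lk [x l * q]mulrC.
    by field; exact: sep.
  - rewrite expr0 expr1 !mulr1 mul1r /rho -jk.
    rewrite (theta_divC _ _ laws (x l)) ?mulf_neq0 //.
    rewrite (theta_divC _ _ laws (x l)) // [x j * q]mulrC.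
    have := sep j l; rewrite eq_sym => /(_ lj) h.
    by field; rewrite h !x0 q0.
  - by rewrite expr0 !mulr1.
rewrite /Delta; under eq_bigr do under eq_bigr do rewrite pairE //.
under eq_bigr do rewrite big_split /=; rewrite big_split /=; congr (_ * _).
under eq_bigr do rewrite big_split /= -big_mkcondr -big_mkcondr /=.
rewrite big_split /= [RHS](bigID (fun j : 'I_n => (j < k)%N)) /=; congr (_ * _).
  transitivity (\prod_(j < n | (j < k)%N) rho j); last first.
    apply: eq_bigl => j; rewrite andbC; case: ltnP => //= jk.
    by rewrite -val_eqE /= ltn_eqF.
  rewrite [RHS]big_mkcond; apply: eq_bigr => j _.
  case: ltnP => jk.
    by rewrite (big_pred1 k) // => l /=; case: eqVneq => [->|_]; rewrite ?jk ?andbF.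
  rewrite big_pred0 // => l; case: eqVneq => [->|_]; rewrite ?andbF // andbT.
  by rewrite ltnNge jk.
transitivity (\prod_(j < n | (k < j)%N) rho j); last first.
  by apply: eq_bigl => j; rewrite -leqNgt ltn_neqAle eq_sym.
rewrite (bigD1 k) //= [X in _ * X]big1 ?mulr1 => [|j jk].
  by apply: eq_bigl => l; rewrite eqxx andbT.
by rewrite big_pred0 // => l; rewrite (negbTE jk) andbF.
Qed.

Definition series_term z a (b c d e : K) y : K :=
  Delta p (fun k => z k * q ^+ y k) / Delta p z
  * (\prod_(j < n) \prod_(k < n) (ep (a j * z k) (y k) / ep (q * z k / z j) (y k)))
  * (\prod_(k < n)
       ((ep (b * z k) (y k) * ep (c * z k) (y k))
        / (ep (d * z k) (y k) * ep (e * z k) (y k)))).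

Lemma series_term_incr z a b c d e y k (x := fun j => z j * q ^+ y j) :
  (forall j, z j != 0) -> (forall i j, i != j -> th (x i / x j) != 0) ->
  series_term z a b c d e (incr y k) = series_term z a b c d e y *
  (\prod_(j < n | j != k) (th (q * x k / x j) / th (x k / x j)) *
   \prod_(j < n) (th (a j * x k) / th (q * x k / z j)) *
   (th (b * x k) * th (c * x k) / (th (d * x k) * th (e * x k)))).
Proof.
move=> z0 sep; rewrite /series_term.
have x0 j : x j != 0 by rewrite mulf_neq0 ?expf_neq0.
have -> : (fun j => z j * q ^+ incr y k j) = (fun j => x j * q ^+ (j == k)).
  by apply: funext => j; rewrite /incr exprD mulrA.
rewrite Delta_incr //.
have at_k (G : 'I_n -> nat -> K) (H : 'I_n -> K) : G k (y k).+1 = G k (y k) * H k ->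
    \prod_(j < n) G j (incr y k j) = \prod_(j < n) G j (y j) * H k.
  move=> GH; rewrite (bigD1 k) //= [X in _ = X * _](bigD1 k) //= /incr eqxx addn1 GH.
  rewrite [RHS]mulrAC; congr (_ * _); apply: eq_bigr => j jk.
  by rewrite (negbTE jk) addn0.
have -> : \prod_(j < n) \prod_(l < n)
     (ep (a j * z l) (incr y k l) / ep (q * z l / z j) (incr y k l)) =
   \prod_(j < n) \prod_(l < n) (ep (a j * z l) (y l) / ep (q * z l / z j) (y l)) *
   \prod_(j < n) (th (a j * x k) / th (q * x k / z j)).
  rewrite -big_split; apply: eq_bigr => j _ /=.
  apply: (at_k (fun l m => ep (a j * z l) m / ep (q * z l / z j) m)
    (fun l => th (a j * x l) / th (q * x l / z j))).
  rewrite !epochSr invfM mulrACA /x; congr (_ * (th _ / th _)); first by rewrite mulrA.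
  by rewrite mulrAC !mulrA.
rewrite (at_k (fun l m => (ep (b * z l) m * ep (c * z l) m) / (ep (d * z l) m * ep (e * z l) m))
  (fun l => (th (b * x l) * th (c * x l) / (th (d * x l) * th (e * x l))))); last first.
  by rewrite !epochSr !invfM /x !mulrA; ring.
by rewrite -/x; ring.
Qed.

(** For [m = 0] this expresses that [Delta] does not vanish, for [m > 0] that the denominators built
    on [q * z i / z j] do not; [i = j] covers theta at powers of [q]. *)
Definition theta_separated z N := forall m i j, (m <= N)%N -> (0 < m)%N || (i != j) ->
  th (q ^+ m * (z i / z j)) != 0.
Definition theta_regular u z N := forall k m, (m < N)%N -> th (u * z k * q ^+ m) != 0.

Lemma theta_separated_point z N y : (forall j, z j != 0) -> theta_separated z N ->
  (forall j, (y j <= N)%N) ->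
  forall i j, i != j -> th (z i * q ^+ y i / (z j * q ^+ y j)) != 0.
Proof.
move=> z0 sep yN.
have wlog_le i j : i != j -> (y j <= y i)%N ->
    th (z i * q ^+ y i / (z j * q ^+ y j)) != 0.
  move=> ij ji.
  have -> : z i * q ^+ y i / (z j * q ^+ y j) = q ^+ (y i - y j) * (z i / z j).
    by rewrite -{1}(subnK ji) exprD; field; rewrite z0 expf_neq0.
  by apply: sep; rewrite ?ij ?orbT // (leq_trans (leq_subr _ _)).
move=> i j ij; have [ji|/ltnW ji] := leqP (y j) (y i); first exact: wlog_le.
have xk k : z k * q ^+ y k != 0 by rewrite mulf_neq0 ?expf_neq0.
rewrite (theta_divC _ _ laws) // mulf_neq0 ?oppr_eq0 ?(mulf_neq0 (xk i)) ?invr_eq0 //.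
by apply: wlog_le => //; rewrite eq_sym.
Qed.

Lemma series_term_swap z a b c d e y : series_term z a b c d e y = series_term z a b c e d y.
Proof.
by congr (_ * _); apply: eq_bigr => k _; rewrite [ep (d * _) _ * _]mulrC.
Qed.

(** An instance of [epoch_shift] in every coordinate, cleared of divisions because these thetas may
    vanish. *)
Lemma series_term_shift_num z a b c d e y :
  series_term z a b c d e y * \prod_k th (b * (z k * q ^+ y k)) =
  series_term z a (q * b) c d e y * \prod_k th (b * z k).
Proof.
rewrite /series_term -[LHS]mulrA -[RHS]mulrA; congr (_ * _); rewrite -!big_split.
apply: eq_bigr => k _ /=.
have E : ep (b * z k) (y k) * th (b * (z k * q ^+ y k)) =
    th (b * z k) * ep (q * b * z k) (y k) by rewrite mulrA epoch_shift mulrA.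
transitivity (ep (b * z k) (y k) * th (b * (z k * q ^+ y k)) * (ep (c * z k) (y k)
  / (ep (d * z k) (y k) * ep (e * z k) (y k)))); first by ring.
by rewrite E; ring.
Qed.

Lemma series_term_shift_den z a b c d e y :
  (forall k, ep (d * z k) (y k) != 0) ->
  (forall k, th (d * (z k * q ^+ y k)) != 0) ->
  series_term z a b c d e y * \prod_k th (d * z k) =
  series_term z a b c (q * d) e y * \prod_k th (d * (z k * q ^+ y k)).
Proof.
move=> d0 dx0; rewrite /series_term -[LHS]mulrA -[RHS]mulrA; congr (_ * _); rewrite -!big_split.
apply: eq_bigr => k _ /=.
have E : ep (d * z k) (y k) * th (d * (z k * q ^+ y k)) =
    th (d * z k) * ep (q * d * z k) (y k) by rewrite mulrA epoch_shift mulrA.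
have /andP[dz0 qd0] : (th (d * z k) != 0) && (ep (q * d * z k) (y k) != 0).
  by rewrite -negb_or -mulf_eq0 -E mulf_neq0.
set A := ep (d * z k) (y k) in E d0 *; set B := ep (q * d * z k) (y k) in E qd0 *.
have AB : th (d * z k) / A = th (d * (z k * q ^+ y k)) / B.
  have A0 : A != 0 by exact: d0.
  by apply/eqP; rewrite eqr_div ?d0 // -E mulrC.
rewrite !invfM; transitivity (ep (b * z k) (y k) * ep (c * z k) (y k) *
   (th (d * z k) / A) / ep (e * z k) (y k)); first by ring.
by rewrite AB; ring.
Qed.

(** Partial fractions at the points [x k] with the pole 1/b and zeros at [q ^+ N.+1 / b] and all
    [z j]. The weight of [k] contains theta at [x k / z k], hence vanishes if [y k = 0]: each term
    is distributed over its predecessors. *)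
Lemma series_term_weights z a b c d e y N (x := fun j => z j * q ^+ y j) :
  (forall j, z j != 0) -> b != 0 -> (\sum_j y j = N.+1)%N ->
  theta_separated z N.+1 -> theta_regular b z N.+2 -> th (q ^+ N.+1) != 0 ->
  series_term z a b c d e y = \sum_k (th (q ^+ N.+1))^-1 * series_term z a (q * b) c d e y *
    (th (b * x k / q ^+ N.+1) * \prod_j th (x k / z j)) /
    (th (b * x k) * \prod_(j | j != k) th (x k / x j)).
Proof.
move=> z0 b0 yN sep reg qN.
have x0 j : x j != 0 by rewrite mulf_neq0 ?expf_neq0.
have yle j : (y j <= N.+1)%N by rewrite -yN (bigD1 j) //= leq_addr.
have sepx i j : i != j -> th (x i / x j) != 0 by exact: theta_separated_point z0 sep yle _ _.
have bx0 k : th (b * x k) != 0 by rewrite mulrA; apply: reg; rewrite ltnS.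
have qN0 : q ^+ N.+1 != 0 by rewrite expf_neq0.
have prodx : \prod_k x k = q ^+ N.+1 * \prod_k z k.
  by rewrite big_split /= mulrC -yN -expr_sum.
have bz0 k : th (b * z k) != 0 by have := reg k 0%N isT; rewrite expr0 mulr1.
have V : series_term z a b c d e y * \prod_k th (b * x k) =
    series_term z a (q * b) c d e y * \prod_k th (b * z k) by exact: series_term_shift_num.
clearbody x; have xu k : th (x k / b^-1) = th (b * x k) by rewrite invrK mulrC.
have sepu k : th (x k / b^-1) != 0 by rewrite xu.
have prod_codom (G : K -> K) : \prod_(t <- codom z) G t = \prod_j G (z j).
  by rewrite big_image; apply: eq_bigl.
have all_codom : all (fun t => t != 0) (q ^+ N.+1 / b :: codom z).
  by rewrite /= mulf_neq0 ?invr_eq0 //; apply/allP => _ /codomP[k ->].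
have bal : b^-1 * \prod_k x k = \prod_(t <- q ^+ N.+1 / b :: codom z) t.
  by rewrite big_cons prod_codom prodx; ring.
have := partial_fractions1 _ _ laws _ x _ _ x0 (invr_neq0 b0) all_codom _ sepx sepu bal.
rewrite /= size_codom => /(_ erefl).
rewrite big_cons prod_codom -mulrA -prodf_div.
have -> : \prod_j (th (b^-1 / z j) / th (b^-1 / x j)) =
    q ^+ N.+1 * (\prod_j th (b * z j) / \prod_j th (b * x j)).
  have z_neq0 : \prod_k z k != 0 by apply/prodf_neq0 => k _; exact: z0.
  rewrite -prodf_div -[q ^+ N.+1](mulfK z_neq0) -prodx -prodf_div -big_split.
  apply: eq_bigr => j _ /=; rewrite -!invfM !(theta_lawsV _ _ laws) ?mulf_neq0 //.
  by have := bx0 j; have := x0 j; have := z0 j => h1 h2 h3; field; rewrite b0 h1 h2 h3.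
(* The extra zero meets the pole in theta at [q ^+ N.+1] inverted, whence the normalisation of the
   weights. *)
have -> : b^-1 / (q ^+ N.+1 / b) = (q ^+ N.+1)^-1 by field; rewrite b0 expf_neq0.
rewrite (theta_lawsV _ _ laws) // => E.
have bx_neq0 : \prod_j th (b * x j) != 0 by apply/prodf_neq0 => k _; exact: bx0.
have {}E : \sum_k (th (b * x k / q ^+ N.+1) * \prod_j th (x k / z j)) /
    (th (b * x k) * \prod_(j | j != k) th (x k / x j)) =
    th (q ^+ N.+1) * (\prod_j th (b * z j) / \prod_j th (b * x j)).
  transitivity (- (- th (q ^+ N.+1) / q ^+ N.+1 * (q ^+ N.+1 *
      (\prod_j th (b * z j) / \prod_j th (b * x j))))); last by field; rewrite bx_neq0.
  rewrite -E; apply: eq_bigr => k _; rewrite big_cons prod_codom xu.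
  by congr (th _ * _ / _); field; rewrite b0.
under eq_bigr do rewrite -mulrA.
rewrite -mulr_sumr E.
apply: (mulIf bx_neq0); rewrite V; field.
by rewrite qN bx_neq0.
Qed.

(** The coefficient C(d,e): the contribution of the pole 1/d, stripped of its dependence on [y]. *)
Definition recursion_coef z a (b c d e : K) N :=
  - (q ^+ N * (- d) ^+ n * \prod_k z k) *
  (th (b / q ^+ N / d) * (th (c / d) * \prod_k th (a k / d))) /
  (th (q ^+ N.+1) * th (e / d) * \prod_k th (d * z k)).

(** Passing from [y] to its successor cancels the weight's thetas at [x' k / z j] and in its
    denominator. What is left is a summand of partial fractions with the poles 1/d and 1/e. *)
Lemma weight_incr z a b c d e y N k (x := fun j => z j * q ^+ y j)
    (x' := fun j => z j * q ^+ incr y k j) :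
  (forall j, z j != 0) -> (\sum_j y j = N)%N ->
  theta_separated z N.+1 -> theta_regular b z N.+2 ->
  theta_regular d z N.+1 -> theta_regular e z N.+1 ->
  series_term z a (q * b) c d e (incr y k) *
    (th (b * x' k / q ^+ N.+1) * \prod_j th (x' k / z j)) /
    (th (b * x' k) * \prod_(j | j != k) th (x' k / x' j)) =
  series_term z a (q * b) c d e y *
    ((th (b * x k / q ^+ N) * (th (c * x k) * \prod_j th (a j * x k))) /
     (th (d * x k) * th (e * x k) * \prod_(j | j != k) th (x k / x j))).
Proof.
move=> z0 yN sep regb regd rege.
have x0 j : x j != 0 by rewrite mulf_neq0 ?expf_neq0.
have yle j : (y j <= N)%N by rewrite -yN (bigD1 j) //= leq_addr.
have yle1 j : (incr y k j <= N.+1)%N by rewrite /incr; have := yle j; case: eqP; lia.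
have sepx i j : i != j -> th (x i / x j) != 0.
  by apply: (theta_separated_point _ _ _ z0 sep) => l; exact: leqW.
have sepx' i j : i != j -> th (x' i / x' j) != 0.
  exact: (theta_separated_point _ _ _ z0 sep yle1).
have x'k : x' k = q * x k by rewrite /x' /incr eqxx addn1 exprS /x; ring.
have x'j j : j != k -> x' j = x j.
  by move=> jk; rewrite /x' /incr (negbTE jk) addn0.
have -> : series_term z a (q * b) c d e (incr y k) = series_term z a (q * b) c d e y *
  (\prod_(j < n | j != k) (th (q * x k / x j) / th (x k / x j)) *
   \prod_(j < n) (th (a j * x k) / th (q * x k / z j)) *
   (th (q * b * x k) * th (c * x k) / (th (d * x k) * th (e * x k)))).
  exact: series_term_incr.
rewrite !x'k.
have bx : th (b * (q * x k)) != 0.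
  have := regb k (y k).+1; rewrite !ltnS exprS => /(_ (yle k)).
  by congr (th _ != 0); rewrite /x; ring.
have dx : th (d * x k) != 0 by rewrite mulrA; apply: regd; rewrite ltnS.
have ex : th (e * x k) != 0 by rewrite mulrA; apply: rege; rewrite ltnS.
have prod1 : \prod_j th (q * x k / z j) != 0.
  apply/prodf_neq0 => j _; have := sep (y k).+1 k j.
  rewrite ltnS yle => /(_ isT isT); congr (th _ != 0).
  by rewrite /x exprS; ring.
have -> : \prod_(j | j != k) th (q * x k / x' j) = \prod_(j | j != k) th (q * x k / x j).
  by apply: eq_bigr => j jk; rewrite x'j.
have prod2 : \prod_(j | j != k) th (q * x k / x j) != 0.
  by apply/prodf_neq0 => j jk; rewrite -x'k -(x'j j jk) sepx' // eq_sym.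
have prod3 : \prod_(j | j != k) th (x k / x j) != 0.
  by apply/prodf_neq0 => j jk; rewrite sepx // eq_sym.
have -> : b * (q * x k) / q ^+ N.+1 = b * x k / q ^+ N.
  by rewrite exprS; field; rewrite q0 expf_neq0.
have -> : q * b * x k = b * (q * x k) by ring.
rewrite !prodf_div; clearbody x; field.
by rewrite bx dx ex prod1 prod2 prod3.
Qed.

(** Inversion turns the denominator at 1/d into the thetas at [d * x k], which
    [series_term_shift_den] absorbs by replacing [d] with [q * d]. In use [b'] is [q * b]. *)
Lemma residue z a b b' c d e y N (x := fun j => z j * q ^+ y j) :
  (forall j, z j != 0) -> d != 0 -> (\sum_j y j = N)%N ->
  theta_regular d z N.+1 -> th (q ^+ N.+1) != 0 -> th (e / d) != 0 ->
  - (series_term z a b' c d e y * ((th (b / q ^+ N / d) * (th (c / d) * \prod_j th (a j / d))) /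
     (th (e / d) * \prod_k th (d^-1 / x k)))) =
  th (q ^+ N.+1) * (recursion_coef z a b c d e N * series_term z a b' c (q * d) e y).
Proof.
move=> z0 d0 yN reg qN ed.
have x0 j : x j != 0 by rewrite mulf_neq0 ?expf_neq0.
have yle j : (y j <= N)%N by rewrite -yN (bigD1 j) //= leq_addr.
have dx k : th (d * x k) != 0 by rewrite mulrA; apply: reg; rewrite ltnS.
have epd k : ep (d * z k) (y k) != 0.
  apply/epoch_neq0P => j jy; apply: reg; rewrite ltnS.
  by apply: leq_trans (yle k); exact: ltnW.
have V : series_term z a b' c d e y * \prod_k th (d * z k) =
    series_term z a b' c (q * d) e y * \prod_k th (d * x k) by exact: series_term_shift_den.
have prodx : \prod_k x k = q ^+ N * \prod_k z k.
  by rewrite big_split /= mulrC -yN -expr_sum.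
have dz k : th (d * z k) != 0 by have := reg k 0%N isT; rewrite expr0 mulr1.
have dx0 : \prod_k th (d * x k) != 0 by apply/prodf_neq0 => k _; exact: dx.
have dz0 : \prod_k th (d * z k) != 0 by apply/prodf_neq0 => k _; exact: dz.
have px0 : \prod_k x k != 0 by apply/prodf_neq0 => k _; exact: x0.
clearbody x.
have -> : \prod_k th (d^-1 / x k) = \prod_k th (d * x k) / ((- d) ^+ n * \prod_k x k).
  rewrite -[n in X in _ / (X * _)]card_ord -prodr_const -big_split -prodf_div /=.
  apply: eq_bigr => k _; rewrite -invfM (theta_lawsV _ _ laws) ?mulf_neq0 //.
  by field; rewrite x0 d0.
have VE : series_term z a b' c d e y =
    series_term z a b' c (q * d) e y * (\prod_k th (d * x k) / \prod_k th (d * z k)).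
  by apply: (mulIf dz0); rewrite V mulrA divfK.
rewrite VE /recursion_coef.
have -> : q ^+ N * (- d) ^+ n * \prod_k z k = (- d) ^+ n * \prod_k x k.
  by rewrite prodx; ring.
field.
by rewrite ed dx0 dz0 qN px0 expf_neq0 ?oppr_eq0.
Qed.

Variable M : nat.
Local Notation Y := {ffun 'I_n -> 'I_M.+1}.
(** The range of the entries depends on the fixed [M], not on [N], so the induction on [N] keeps a
    single index type. *)
Definition lattice_sum z a (b c d e : K) N :=
  \sum_(y : Y | (\sum_j y j == N)%N) series_term z a b c d e (fun j => y j).

Lemma lattice_sum_recursion z a b c d e N : (N < M)%N ->
  (forall j, z j != 0) -> (forall j, a j != 0) ->
  b != 0 -> c != 0 -> d != 0 -> e != 0 ->
  d * e = \prod_k a k * b * c * \prod_k z k ->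
  theta_separated z N.+1 -> th (q ^+ N.+1) != 0 ->
  theta_regular b z N.+2 -> theta_regular d z N.+1 -> theta_regular e z N.+1 ->
  th (e / d) != 0 ->
  lattice_sum z a b c d e N.+1 =
    recursion_coef z a b c d e N * lattice_sum z a (q * b) c (q * d) e N +
    recursion_coef z a b c e d N * lattice_sum z a (q * b) c d (q * e) N.
Proof.
move=> NM z0 a0 b0 c0 d0 e0 bal sep qN regb regd rege ed.
have de : th (d / e) != 0.
  by rewrite (theta_divC _ _ laws) // mulf_neq0 // oppr_eq0 mulf_neq0 ?invr_eq0.
rewrite /lattice_sum !mulr_sumr -big_split /=.
pose w k (y : 'I_n -> nat) := (th (q ^+ N.+1))^-1 * series_term z a (q * b) c d e y *
    (th (b * (z k * q ^+ y k) / q ^+ N.+1) * \prod_j th (z k * q ^+ y k / z j)) /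
    (th (b * (z k * q ^+ y k)) * \prod_(j | j != k) th (z k * q ^+ y k / (z j * q ^+ y j))).
transitivity (\sum_(y : Y | (\sum_j y j == N.+1)%N) \sum_k w k (fun j => y j)).
  apply: eq_bigr => y /eqP yN.
  exact: (series_term_weights _ _ _ _ _ _ _ _ z0 b0 yN sep regb qN).
(* Exchange the sums and pass to predecessors; the weight vanishes at [y k = 0] since theta does at
   1. *)
have shift k : \sum_(y : Y | (\sum_j y j == N.+1)%N) w k (fun j => y j) =
    \sum_(y : Y | (\sum_j y j == N)%N) w k (incr (fun j => y j) k).
  apply: (sum_incr K n M N k (w k) NM) => y yk.
  rewrite /w yk expr0 mulr1 [\prod_j th (z k / z j)](bigD1 k) //=.
  by rewrite divff // (theta_laws1 _ _ laws) mul0r !mulr0 mul0r.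
rewrite exchange_big /= (eq_bigr _ (fun k _ => shift k)) exchange_big /=.
apply: eq_bigr => y /eqP yN.
pose x j := z j * q ^+ y j.
have x0 j : x j != 0 by rewrite mulf_neq0 ?expf_neq0.
have prodx : \prod_k x k = q ^+ N * \prod_k z k.
  by rewrite big_split /= mulrC -yN -expr_sum.
have yle (j : 'I_n) : (y j <= N)%N by rewrite -yN (bigD1 j) //= leq_addr.
have sepx i j : i != j -> th (x i / x j) != 0.
  exact: (theta_separated_point z N.+1 (fun j => y j) z0 sep (fun l => leqW (yle l))).
have du k : th (x k / d^-1) = th (d * x k) by rewrite invrK mulrC.
have eu k : th (x k / e^-1) = th (e * x k) by rewrite invrK mulrC.
have dx k : th (x k / d^-1) != 0 by rewrite du mulrA; apply: regd; rewrite ltnS.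
have ex k : th (x k / e^-1) != 0 by rewrite eu mulrA; apply: rege; rewrite ltnS.
have edE : d^-1 / e^-1 = e / d by rewrite invrK mulrC.
have deE : e^-1 / d^-1 = d / e by rewrite invrK mulrC.
pose bs := [:: q ^+ N / b, c^-1 & codom (fun j => (a j)^-1)].
have prod_codom (G : K -> K) : \prod_(t <- codom (fun j => (a j)^-1)) G t =
    \prod_j G (a j)^-1.
  by rewrite big_image; apply: eq_bigl.
have bs0 : all (fun t => t != 0) bs.
  rewrite /= mulf_neq0 ?invr_eq0 ?expf_neq0 //= c0 /=.
  by apply/allP => _ /codomP[k ->]; rewrite invr_eq0.
have bsE u : \prod_(t <- bs) th (u / t) =
    th (b * u / q ^+ N) * (th (c * u) * \prod_j th (a j * u)).
  rewrite !big_cons prod_codom; congr (th _ * (th _ * _)).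
  - by field; rewrite b0 expf_neq0.
  - by rewrite invrK mulrC.
  - by apply: eq_bigr => j _; rewrite invrK mulrC.
(* The balancing condition on [d * e] enters here, for the second use of partial fractions. *)
have bal' : d^-1 * (e^-1 * \prod_k x k) = \prod_(t <- bs) t.
  rewrite !big_cons prod_codom prodx prodfV.
  have pa0 : \prod_j a j != 0 by apply/prodf_neq0 => j _; exact: a0.
  have -> : d^-1 * (e^-1 * (q ^+ N * \prod_k z k)) = q ^+ N * \prod_k z k / (d * e).
    by field; rewrite d0 e0.
  have pz0 : \prod_j z j != 0 by apply/prodf_neq0 => j _; exact: z0.
  by rewrite bal; field; rewrite pa0 pz0 b0 c0.
have sbs : size bs = #|'I_n|.+2 by rewrite /= size_codom.
have uv : th (d^-1 / e^-1) != 0 by rewrite edE.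
have := partial_fractions2 _ _ laws _ x _ _ bs x0 (invr_neq0 d0) (invr_neq0 e0)
  bs0 sbs sepx dx ex uv bal'.
rewrite !bsE edE deE => E.
transitivity ((th (q ^+ N.+1))^-1 * (series_term z a (q * b) c d e (fun j => y j) *
  \sum_k (\prod_(t <- bs) th (x k / t)) /
    (th (x k / d^-1) * th (x k / e^-1) * \prod_(j | j != k) th (x k / x j)))).
  rewrite !mulr_sumr; apply: eq_bigr => k _.
  rewrite bsE du eu -(weight_incr z a b c d e _ N k z0 yN sep regb regd rege) /w.
  by ring.
have R1 : - (series_term z a (q * b) c d e (fun j => y j) *
    ((th (b / d / q ^+ N) * (th (c / d) * \prod_j th (a j / d))) /
     (th (e / d) * \prod_k th (d^-1 / x k)))) =
    th (q ^+ N.+1) * (recursion_coef z a b c d e N *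
      series_term z a (q * b) c (q * d) e (fun j => y j)).
  by rewrite (mulrAC b); exact: residue.
(* The pole 1/e is treated as the pole 1/d with [d] and [e] exchanged. *)
have R2 : - (series_term z a (q * b) c d e (fun j => y j) *
    ((th (b / e / q ^+ N) * (th (c / e) * \prod_j th (a j / e))) /
     (th (d / e) * \prod_k th (e^-1 / x k)))) =
    th (q ^+ N.+1) * (recursion_coef z a b c e d N *
      series_term z a (q * b) c d (q * e) (fun j => y j)).
  by rewrite (mulrAC b) series_term_swap [in RHS]series_term_swap; exact: residue.
by rewrite E mulrDr !mulrN R1 R2 -mulrDr mulKf.
Qed.

(** * The prefactor and the induction on N *)

Definition prefactor z a d e N :=
  \prod_(j < n) (((a j * z j) ^+ N * ep (d / a j) N * ep (e / a j) N)
                 / (ep (d * z j) N * ep (e * z j) N)).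

Lemma prefactorC z a d e N : prefactor z a d e N = prefactor z a e d N.
Proof.
by apply: eq_bigr => j _; rewrite [ep (d * _) _ * _]mulrC [X in X / _]mulrAC.
Qed.

(** The thetas at [e / d], [c / d] and [b / q ^+ N / d] are the same on both sides after the
    substitution of parameters. The remaining parts are products over [j] and agree factor by
    factor. *)
Lemma recursion_coef_prefactor z a b c d e N (s := (q ^+ N)^-1) :
  (forall j, z j != 0) -> (forall j, a j != 0) -> d != 0 -> e != 0 ->
  theta_regular d z N.+1 -> theta_regular e z N.+1 ->
  theta_regular (s / e) a N.+1 ->
  recursion_coef z a b c d e N * prefactor z a (q * d) e N =
  prefactor z a d e N.+1 *
    recursion_coef a z (s * b / (d * e)) (s * c / (d * e)) (s / e) (s / d) N.
Proof.
move=> z0 a0 d0 e0 regd rege regE.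
have qN0 : q ^+ N != 0 by rewrite expf_neq0.
have s0 : s != 0 by rewrite invr_eq0.
rewrite /recursion_coef.
have -> : s * b / (d * e) / q ^+ N / (s / e) = b / q ^+ N / d.
  by field; rewrite ?e0 ?s0 ?d0 ?qN0.
have -> : s * c / (d * e) / (s / e) = c / d by field; rewrite ?e0 ?s0 ?d0 ?qN0.
have -> : s / d / (s / e) = e / d by field; rewrite ?e0 ?s0 ?d0 ?qN0.
have factor j : - d * z j * th (a j / d) / th (d * z j) *
    (((a j * z j) ^+ N * ep (q * d / a j) N * ep (e / a j) N)
                 / (ep (q * d * z j) N * ep (e * z j) N)) =
    ((a j * z j) ^+ N.+1 * ep (d / a j) N.+1 * ep (e / a j) N.+1)
                 / (ep (d * z j) N.+1 * ep (e * z j) N.+1) *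
    (- (s / e) * a j * th (z j / (s / e)) / th (s / e * a j)).
  have E0 : s / e * a j != 0 by rewrite !mulf_neq0 ?invr_eq0.
  have sE : s / e * a j = (e / a j * q ^+ N)^-1.
    by rewrite /s; field; rewrite a0 e0 qN0.
  have := regE j 0%N isT; rewrite expr0 mulr1 sE.
  have w0 : e / a j * q ^+ N != 0 by rewrite !mulf_neq0 ?invr_eq0.
  rewrite (theta_lawsV _ _ laws) // mulf_eq0 oppr_eq0 negb_or => /andP[hE _].
  have zE : z j / (s / e) = e * z j * q ^+ N by rewrite /s; field; rewrite e0 qN0.
  rewrite zE (theta_divC _ _ laws) //.
  rewrite (epochSl (d / a j)) (epochSl (d * z j)) !epochSr exprS !(mulrA q).
  have dz : th (d * z j) != 0 by have := regd j 0%N isT; rewrite expr0 mulr1.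
  have dzN : ep (q * d * z j) N != 0.
    apply/epoch_neq0P => m mN; have := regd j m.+1 mN; congr (th _ != 0).
    by rewrite exprS; ring.
  have ez : th (e * z j * q ^+ N) != 0 by apply: rege.
  have ezN : ep (e * z j) N != 0.
    by apply/epoch_neq0P => m mN; apply: rege; exact: ltnW.
  rewrite /s; field.
  by rewrite ?hE ?dz ?dzN ?ez ?ezN ?a0 ?z0 ?e0 ?d0 ?qN0.
have prodE (u : K) (x f g : 'I_n -> K) : \prod_j (u * x j * f j / g j) =
    u ^+ n * \prod_j x j * \prod_j f j / \prod_j g j.
  by rewrite prodf_div !big_split /= prodr_const card_ord.
have prods : (- d) ^+ n * \prod_j z j * \prod_j th (a j / d) / \prod_j th (d * z j) *
    prefactor z a (q * d) e N = prefactor z a d e N.+1 *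
    ((- (s / e)) ^+ n * \prod_j a j * \prod_j th (z j / (s / e)) / \prod_j th (s / e * a j)).
  by rewrite -!prodE -!big_split; apply: eq_bigr => j _; exact: factor.
set TZ := \prod_j th (z j / (s / e)) in prods *; rewrite !invfM.
transitivity (- q ^+ N * th (b / q ^+ N / d) * th (c / d) / th (q ^+ N.+1) / th (e / d) *
  ((- d) ^+ n * \prod_j z j * \prod_j th (a j / d) / \prod_j th (d * z j) *
    prefactor z a (q * d) e N)); first by ring.
by rewrite prods; ring.
Qed.

Lemma theta_separated_le z m N : (m <= N)%N -> theta_separated z N -> theta_separated z m.
Proof. by move=> mN sep l i j lm; apply: sep; exact: leq_trans mN. Qed.

Lemma theta_regular_le u z m N : (m <= N)%N -> theta_regular u z N -> theta_regular u z m.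
Proof. by move=> mN reg k l lm; apply: reg; exact: leq_trans mN. Qed.

Lemma theta_regularS u z N : theta_regular u z N.+1 -> theta_regular (q * u) z N.
Proof.
move=> reg k m mN; have := reg k m.+1 mN; congr (th _ != 0).
by rewrite exprS; ring.
Qed.

Lemma lattice_sum0 z a b c d e : theta_separated z 0 -> (forall j, z j != 0) ->
  lattice_sum z a b c d e 0 = 1.
Proof.
move=> sep z0; have D0 : Delta p z != 0.
  apply/prodf_neq0 => i _; apply/prodf_neq0 => j ij; rewrite mulf_neq0 //.
  have := sep 0%N j i; rewrite expr0 mul1r; apply => //=.
  by rewrite eq_sym -val_eqE /= ltn_eqF.
rewrite /lattice_sum (big_pred1 [ffun=> ord0]) => [|y /=]; last first.
  rewrite sum_nat_eq0; apply/forallP/eqP => [y0|-> j]; last by rewrite ffunE.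
  by apply/ffunP => j; apply: val_inj; rewrite ffunE /=; exact/eqP/y0.
have -> : (fun j : 'I_n => nat_of_ord ([ffun=> ord0] j : 'I_M.+1)) = (fun=> 0%N).
  by apply: funext => j; rewrite ffunE.
rewrite /series_term; have -> : (fun k : 'I_n => z k * q ^+ 0) = z.
  by apply: funext => k; rewrite expr0 mulr1.
rewrite divff // big1 ?big1 ?mulr1 // => [k _|j _]; rewrite /epoch ?big_nil ?mulr1 ?divr1 //.
by rewrite big1 // => k _; rewrite !big_nil divr1.
Qed.

(** Induction on [N] with [z] and [a] fixed. The last hypothesis ranges over powers of [q] of both
    signs because the recursion multiplies either [d] or [e] by [q]. *)
Lemma transformation_generic N z a b c d e (s := q ^ (1 - N%:Z)) : (N <= M)%N ->
  (forall j, z j != 0) -> (forall j, a j != 0) ->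
  b != 0 -> c != 0 -> d != 0 -> e != 0 ->
  d * e = \prod_k a k * b * c * \prod_k z k ->
  theta_separated z N -> theta_separated a N ->
  (forall m, (0 < m <= N)%N -> th (q ^+ m) != 0) ->
  theta_regular b z N.+1 -> theta_regular (s * b / (d * e)) a N.+1 ->
  theta_regular d z N -> theta_regular e z N ->
  theta_regular (s / d) a N -> theta_regular (s / e) a N ->
  (forall i : int, (absz i <= N)%N -> th (q ^ i * (e / d)) != 0) ->
  lattice_sum z a b c d e N = prefactor z a d e N *
    lattice_sum a z (s * b / (d * e)) (s * c / (d * e)) (s / d) (s / e) N.
Proof.
move=> NM z0 a0; elim: N NM b c d e @s => [|N IH] NM b c d e s b0 c0 d0 e0 bal
  sepz sepa qN regb regB regd rege regD regE ed.
  rewrite !lattice_sum0 // mulr1 /prefactor big1 // => j _.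
  by rewrite /epoch !big_nil !mulr1 divr1.
have sE : s = (q ^+ N)^-1.
  by rewrite /s exprnN; congr (_ ^ _); lia.
have s'E : q ^ (1 - N%:Z) = q * s by rewrite sE expfzDr // expr1z exprnN.
have s0 : s != 0 by rewrite sE invr_eq0 expf_neq0.
have qN1 : th (q ^+ N.+1) != 0 by apply: qN; rewrite /=.
have ed0 : th (e / d) != 0 by have := ed 0 isT; rewrite expr0z mul1r.
have de0 : th (d / e) != 0.
  by rewrite (theta_divC _ _ laws) // mulf_neq0 // oppr_eq0 mulf_neq0 ?invr_eq0.
have B0 : s * b / (d * e) != 0 by rewrite !mulf_neq0 ?invr_eq0 ?mulf_neq0.
have C0 : s * c / (d * e) != 0 by rewrite !mulf_neq0 ?invr_eq0 ?mulf_neq0.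
have D0 : s / d != 0 by rewrite !mulf_neq0 ?invr_eq0.
have E0 : s / e != 0 by rewrite !mulf_neq0 ?invr_eq0.
have ED : s / e / (s / d) = d / e by field; rewrite ?s0 ?e0 ?d0.
have balD : s / d * (s / e) =
    \prod_k z k * (s * b / (d * e)) * (s * c / (d * e)) * \prod_k a k.
  transitivity (s * s / (d * e) / (d * e) * (\prod_k a k * b * c * \prod_k z k)); last by ring.
  by rewrite -bal; field; rewrite ?d0 ?e0.
have sub : (N <= N.+1)%N by [].
have NM' := ltnW NM.
rewrite lattice_sum_recursion // (lattice_sum_recursion a z) ?ED //.
(* Here [s] is [q ^- N], while the induction hypothesis uses [q * s]: shifting [b] and [d]
   multiplies the first and last parameters on the right by [q] and fixes the other two. *)
have IH1 : lattice_sum z a (q * b) c (q * d) e N = prefactor z a (q * d) e N *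
    lattice_sum a z (q * (s * b / (d * e))) (s * c / (d * e)) (s / d) (q * (s / e)) N.
  have BE : q * s * (q * b) / (q * d * e) = q * (s * b / (d * e)) by field; rewrite ?q0 ?d0 ?e0.
  have CE : q * s * c / (q * d * e) = s * c / (d * e) by field; rewrite ?q0 ?d0 ?e0.
  have DE : q * s / (q * d) = s / d by field; rewrite ?q0 ?d0 ?e0.
  have EE : q * s / e = q * (s / e) by rewrite mulrA.
  rewrite IH ?mulf_neq0 // ?s'E ?BE ?CE ?DE ?EE //.
  - by rewrite -mulrA bal; ring.
  - exact: theta_separated_le sepz.
  - exact: theta_separated_le sepa.
  - by move=> m /andP[m0 mN]; apply: qN; rewrite m0 ltnW.
  - exact: theta_regularS.
  - exact: theta_regularS.
  - exact: theta_regularS.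
  - exact: theta_regular_le rege.
  - exact: theta_regular_le regD.
  - exact: theta_regularS.
  - move=> i /absz_le_pred iN; have := ed _ iN; congr (th _ != 0).
    rewrite expfzDr // -invr_expz expr1z.
    by field; rewrite ?q0 ?d0.
have IH2 : lattice_sum z a (q * b) c d (q * e) N = prefactor z a d (q * e) N *
    lattice_sum a z (q * (s * b / (d * e))) (s * c / (d * e)) (q * (s / d)) (s / e) N.
  have BE : q * s * (q * b) / (d * (q * e)) = q * (s * b / (d * e)) by field; rewrite ?q0 ?d0 ?e0.
  have CE : q * s * c / (d * (q * e)) = s * c / (d * e) by field; rewrite ?q0 ?d0 ?e0.
  have EE : q * s / (q * e) = s / e by field; rewrite ?q0 ?d0 ?e0.
  have DE : q * s / d = q * (s / d) by rewrite mulrA.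
  rewrite IH ?mulf_neq0 // ?s'E ?BE ?CE ?DE ?EE //.
  - by rewrite mulrCA bal; ring.
  - exact: theta_separated_le sepz.
  - exact: theta_separated_le sepa.
  - by move=> m /andP[m0 mN]; apply: qN; rewrite m0 ltnW.
  - exact: theta_regularS.
  - exact: theta_regularS.
  - exact: theta_regular_le regd.
  - exact: theta_regularS.
  - exact: theta_regularS.
  - exact: theta_regular_le regE.
  - move=> i /absz_le_succ iN; have := ed _ iN; congr (th _ != 0); rewrite expfzDr // expr1z.
    by ring.
have regD' := regD; have regE' := regE; rewrite sE in regD' regE'.
have M1 := recursion_coef_prefactor z a b c d e N z0 a0 d0 e0 regd rege regE'.
have M2 := recursion_coef_prefactor z a b c e d N z0 a0 e0 d0 rege regd regD'.
rewrite -sE in M1 M2.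
rewrite [e * d]mulrC (prefactorC z a (q * e)) (prefactorC z a e) in M2.
by rewrite IH1 IH2 mulrA M1 [X in _ + X]mulrA M2; ring.
Qed.

End Multisum.

(** * Removing the genericity assumptions *)

Section ComplexTheta.
Local Open Scope classical_set_scope.
Variable R : realType.
Local Notation C := (R[i] : numFieldType).
Variable p : C.
Hypothesis hp : `|p| < 1.

(** Zeros are isolated only in a punctured sense, hence the condition that [f] avoids its limit. *)
Lemma theta_neq0_near_comp (f : C -> C) (l : C) : l != 0 ->
  f t @[t --> (1 : C)^'] --> l -> (\forall t \near (1 : C)^', f t != l) ->
  \forall t \near (1 : C)^', theta p (f t) != 0.
Proof.
move=> l0 fl fne.
have near_l : \forall y \near l, y != l -> theta p y != 0.
  exact: theta_neq0_near.
have near_t : \forall t \near (1 : C)^', f t != l -> theta p (f t) != 0.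
  exact: fl _ near_l.
near=> t; have impl : f t != l -> theta p (f t) != 0 by near: t.
by apply: impl; near: t.
Unshelve. all: by end_near. Qed.

Lemma theta_weierstrass (X b c d e : C) :
  X != 0 -> b != 0 -> c != 0 -> d != 0 -> e != 0 ->
  theta p (X / b) * theta p (X * b / c) * (theta p (c / (d * e)) * theta p (d / e)) =
  theta p (X / d) * theta p (X * d / c) * (theta p (c / (e * b)) * theta p (b / e)) +
  b / e * (theta p (c / (b * d)) * theta p (d / b)) *
    (theta p (X / e) * theta p (X * e / c)).
Proof.
move=> X0 b0 c0 d0 e0.
pose s : C := sqrtC (c : R[i]).
have sK : c = s ^+ 2 by apply/esym; exact: sqrtCK.
have s0 : s != 0 by apply: contraNneq c0 => s0; rewrite sK s0 expr0n.
have div0 (u v : C) : u != 0 -> v != 0 -> u / v != 0.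
  by move=> u0 v0; rewrite mulf_neq0 ?invr_eq0.
have := theta_add _ _ hp (X / s) (s / b) (s / e) (s / d).
move=> /(_ (div0 _ _ X0 s0) (div0 _ _ s0 b0) (div0 _ _ s0 e0) (div0 _ _ s0 d0)).
have argM (u v : C) : u != 0 -> v != 0 -> s / u * (s / v) = c / (u * v).
  by move=> u0 v0; rewrite sK; field; rewrite u0 v0.
have argD (u v : C) : u != 0 -> v != 0 -> s / u / (s / v) = v / u.
  by move=> u0 v0; field; rewrite u0 v0 s0.
have argXM (u : C) : u != 0 -> X / s * (s / u) = X / u.
  by move=> u0; field; rewrite u0 s0.
have argXD (u : C) : u != 0 -> X / s / (s / u) = X * u / c.
  by move=> u0; rewrite sK; field; rewrite u0 s0.
rewrite !argXM // !argXD // !argM // !argD // [e * d]mulrC => /eqP.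
by move=> /eqP /(canRL (subrK _)) ->; rewrite addrC; congr (_ + _); rewrite mulrA.
Qed.

Lemma theta_div0 (x y : C) : x != 0 -> y != 0 ->
  theta p x = 0 -> theta p y = 0 -> theta p (x / y) = 0.
Proof.
move=> x0 y0 px py.
have near1 (w : C) : w != 0 -> \forall t \near (1 : C)^', theta p (w * t) != 0.
  move=> w0; apply: (theta_neq0_near_comp (fun t => w * t) (w * 1)).
  - by rewrite mulr1.
  - by apply: cvgMl_tmp; exact: nbhs_dnbhs.
  - near=> t; rewrite (inj_eq (mulfI w0)); near: t; exact: near_neq.
have [b [b0 pb]] : exists b : C, b != 0 /\ theta p b^-1 != 0.
  have : \forall t \near (1 : C)^', t != 0 /\ theta p (1 * t) != 0.
    near=> t; split; near: t; first exact: near_neq.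
    by apply: near1; exact: oner_neq0.
  move=> /filter_ex [t [t0 pt]]; exists t^-1; rewrite invrK invr_eq0 -[t]mul1r.
  by rewrite mul1r in pt *; rewrite t0.
have [c [c0 pbc pxyc]] : exists c : C, [/\ c != 0, theta p (b / c) != 0
    & theta p (c * (x * y)) != 0].
  have xy0 : (x * y)^-1 != 0 by rewrite invr_eq0 mulf_neq0.
  have : \forall t \near (1 : C)^', [/\ t != 0, theta p (b * t) != 0
      & theta p ((x * y)^-1 * t) != 0].
    near=> t; split; near: t; [exact: near_neq|exact: near1|exact: near1].
  move=> /filter_ex [t [t0 pbt pxyt]]; exists t^-1; rewrite invr_eq0 invrK; split=> //.
  have -> : t^-1 * (x * y) = ((x * y)^-1 * t)^-1 by rewrite invfM invrK mulrC.
  have w0 : (x * y)^-1 * t != 0 by rewrite mulf_neq0.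
  by rewrite (thetaV _ _ hp) // mulf_neq0 ?oppr_eq0 // invr_neq0.
have := theta_weierstrass 1 b c y^-1 x^-1 (oner_neq0 _) b0 c0 _ _.
rewrite !invr_eq0 => /(_ y0 x0).
rewrite !div1r !invrK px py !mul0r !mulr0 addr0 -invfM invrK mul1r mulrC => /eqP.
rewrite [y * x]mulrC [y^-1 * x]mulrC.
by rewrite !mulf_eq0 (negbTE pb) (negbTE pbc) (negbTE pxyc) /= orbF => /eqP.
Unshelve. all: by end_near. Qed.

Lemma complex_theta_laws : theta_laws C (theta p).
Proof.
split; [exact: theta1|exact: thetaV|exact: theta_weierstrass|exact: theta_div0].
Qed.

End ComplexTheta.

(** * Continuity of both sides in b, c, d, e *)

Section Continuity.
Local Open Scope classical_set_scope.
Variable R : realType.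
Local Notation C := (R[i] : numFieldType).
Variables p q : C.
Hypotheses (hp : `|p| < 1) (q0 : q != 0).
Variables (n M : nat) (T : Type) (F : set_system T).
Context {FF : Filter F}.

Lemma epoch_cvg (f : T -> C) (l w : C) m : l != 0 -> w != 0 -> f t @[t --> F] --> l ->
  epoch p q (f t * w) m @[t --> F] --> epoch p q (l * w) m.
Proof.
move=> l0 w0 fl; apply: (@cvg_big C nat _ _ _ (@mul_continuous _)) => j _.
apply: (@cvg_comp _ _ _ (fun t => f t * w * q ^+ j) (theta p) _ (nbhs (l * w * q ^+ j))).
  by apply: (@cvgMr_tmp C); apply: (@cvgMr_tmp C).
by apply: theta_continuous; rewrite ?mulf_neq0 ?expf_neq0.
Qed.

Variables (fb fc fd fe : T -> C) (b c d e : C).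
Hypotheses (b0 : b != 0) (c0 : c != 0) (d0 : d != 0) (e0 : e != 0).
Hypotheses (hfb : fb t @[t --> F] --> b) (hfc : fc t @[t --> F] --> c).
Hypotheses (hfd : fd t @[t --> F] --> d) (hfe : fe t @[t --> F] --> e).

Lemma lattice_sum_cvg (z a : 'I_n -> C) N : (forall j, z j != 0) ->
  (forall y : {ffun 'I_n -> 'I_M.+1}, (\sum_j y j == N)%N ->
     forall k, epoch p q (d * z k) (y k) != 0 /\ epoch p q (e * z k) (y k) != 0) ->
  lattice_sum C p q n M z a (fb t) (fc t) (fd t) (fe t) N @[t --> F] -->
  lattice_sum C p q n M z a b c d e N.
Proof.
move=> z0 den; rewrite /lattice_sum; 
apply: (@cvg_big C _ _ _ _ (@add_continuous C)) => y yN.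
rewrite /series_term; apply: (@cvgMl_tmp C); apply: (@cvg_big C _ _ _ _ (@mul_continuous _)) => k _.
have [dk ek] := den y yN k.
have limM := fun f g l l' => @cvgM C T F FF f g l l'.
have num := limM _ _ _ _ (epoch_cvg fb b (z k) (y k) b0 (z0 k) hfb)
  (epoch_cvg fc c (z k) (y k) c0 (z0 k) hfc).
have den' := limM _ _ _ _ (epoch_cvg fd d (z k) (y k) d0 (z0 k) hfd)
  (epoch_cvg fe e (z k) (y k) e0 (z0 k) hfe).
exact: limM _ _ _ _ num (@cvgV C T F FF _ _ (mulf_neq0 dk ek) den').
Qed.

Lemma prefactor_cvg (z a : 'I_n -> C) N : (forall j, z j != 0) -> (forall j, a j != 0) ->
  (forall k, epoch p q (d * z k) N != 0 /\ epoch p q (e * z k) N != 0) ->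
  prefactor C p q n z a (fd t) (fe t) N @[t --> F] --> prefactor C p q n z a d e N.
Proof.
move=> z0 a0 den; rewrite /prefactor; apply: (@cvg_big C _ _ _ _ (@mul_continuous _)) => k _.
have [dk ek] := den k.
have limM := fun f g l l' => @cvgM C T F FF f g l l'.
have aV0 : (a k)^-1 != 0 by rewrite invr_eq0.
have num := limM _ _ _ _ (@cvgMl_tmp C T F FF _ ((a k * z k) ^+ N) _
  (epoch_cvg fd d (a k)^-1 N d0 aV0 hfd)) (epoch_cvg fe e (a k)^-1 N e0 aV0 hfe).
have den' := limM _ _ _ _ (epoch_cvg fd d (z k) N d0 (z0 k) hfd)
  (epoch_cvg fe e (z k) N e0 (z0 k) hfe).
exact: limM _ _ _ _ num (@cvgV C T F FF _ _ (mulf_neq0 dk ek) den').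
Qed.

End Continuity.

(** * Perturbation of the parameters and passage to the limit *)

Section Transformation.
Local Open Scope classical_set_scope.
Variable R : realType.
Local Notation C := (R[i] : numFieldType).
Variables p q : C.
Hypotheses (hp : `|p| < 1) (q0 : q != 0).
Variables (n N : nat).
Implicit Types (z a : 'I_n -> C) (b c d e : C).

Let id1 : (fun t : C => t) t @[t --> (1 : C)^'] --> (1 : C).
Proof. exact: nbhs_dnbhs. Qed.

Let inv1 : t^-1 @[t --> (1 : C)^'] --> (1 : C).
Proof.
by rewrite -[X in _ --> X]invr1; apply: (@cvgV C); [exact: oner_neq0|exact: id1].
Qed.

Let near0 : \forall t \near (1 : C)^', t != 0.
Proof. exact: near_neq. Qed.

Lemma near_regularM z u m : (forall j, z j != 0) -> u != 0 ->
  \forall t \near (1 : C)^', theta_regular C p q n (u * t) z m.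
Proof.
move=> z0 u0.
have : \forall t \near (1 : C)^', forall k (j : 'I_m), theta p (u * t * z k * q ^+ j) != 0.
  apply: filter_forall => k; apply: filter_forall => j.
  have w0 : u * z k * q ^+ j != 0 by rewrite !mulf_neq0 ?expf_neq0.
  apply: (theta_neq0_near_comp _ _ hp _ (u * 1 * z k * q ^+ j)).
  - by rewrite mulr1.
  - by do 2 apply: (@cvgMr_tmp C); apply: (@cvgMl_tmp C); exact: id1.
  near=> t.
  have tE v : u * v * z k * q ^+ j = u * z k * q ^+ j * v by ring.
  rewrite !tE (inj_eq (mulfI w0)); near: t; exact: near_neq.
by apply: filterS => t reg k j jm; exact: (reg k (Ordinal jm)).
Unshelve. all: by end_near. Qed.

Lemma near_regularV z u m : (forall j, z j != 0) -> u != 0 ->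
  \forall t \near (1 : C)^', theta_regular C p q n (u / t) z m.
Proof.
move=> z0 u0.
have : \forall t \near (1 : C)^', forall k (j : 'I_m), theta p (u / t * z k * q ^+ j) != 0.
  apply: filter_forall => k; apply: filter_forall => j.
  have w0 : u * z k * q ^+ j != 0 by rewrite !mulf_neq0 ?expf_neq0.
  apply: (theta_neq0_near_comp _ _ hp _ (u * 1 * z k * q ^+ j)).
  - by rewrite mulr1.
  - by do 2 apply: (@cvgMr_tmp C); apply: (@cvgMl_tmp C); exact: inv1.
  near=> t.
  have tE v : u * v * z k * q ^+ j = u * z k * q ^+ j * v by ring.
  rewrite !tE (inj_eq (mulfI w0)) invr_eq1; near: t; exact: near_neq.
by apply: filterS => t reg k j jm; exact: (reg k (Ordinal jm)).
Unshelve. all: by end_near. Qed.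

Lemma near_ratio u m : u != 0 ->
  \forall t \near (1 : C)^', forall l : int, (absz l <= m)%N ->
    theta p (q ^ l * (u / t / t)) != 0.
Proof.
move=> u0.
(* [j - m] runs through the integers of absolute value at most [m], so finitely many conditions are
   combined. *)
have : \forall t \near (1 : C)^', forall j : 'I_m.*2.+1,
    theta p (q ^ (j%:Z - m%:Z) * (u / t / t)) != 0.
  apply: filter_forall => j; set w := q ^ _.
  have w0 : w * u != 0 by rewrite mulf_neq0 ?expfz_neq0.
  apply: (theta_neq0_near_comp _ _ hp _ (w * (u * 1 * 1))).
  - by rewrite !mulr1.
  - apply: (@cvgMl_tmp C); apply: (@cvgM C); last exact: inv1.
    by apply: (@cvgMl_tmp C); exact: inv1.
  near=> t; have t0 : t != 0 by near: t; exact: near0.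
  have tE : w * (u / t / t) = w * u * (t ^+ 2)^-1 by field.
  (* The argument depends on [t ^+ 2], so [t = -1] has to be avoided as well as [t = 1]. *)
  rewrite tE !mulr1 -[X in _ != X]mulr1 (inj_eq (mulfI w0)) invr_eq1 sqrf_eq1 negb_or.
  by apply/andP; split; near: t; exact: near_neq.
apply: filterS => t reg l lm.
have lm' : (absz (l + m%:Z)%R < m.*2.+1)%N by lia.
have lE : (Ordinal lm' : nat)%:Z - m%:Z = l by rewrite /=; lia.
by have := reg (Ordinal lm'); rewrite lE.
Unshelve. all: by end_near. Qed.

(** The perturbation keeps [b * c] and [d * e], hence the balancing, and multiplies the parameters
    on the right by t, 1/t, 1/t, t. Near [t = 1] the generic case applies, and both sides are
    continuous because the actual denominators do not vanish at [t = 1]. *)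
Lemma transformation z a b c d e (s := q ^ (1 - N%:Z)) :
  (forall j, z j != 0) -> (forall j, a j != 0) ->
  b != 0 -> c != 0 -> d != 0 -> e != 0 ->
  d * e = \prod_k a k * b * c * \prod_k z k ->
  theta_separated C p q n z N -> theta_separated C p q n a N ->
  (forall m, (0 < m <= N)%N -> theta p (q ^+ m) != 0) ->
  (forall y : {ffun 'I_n -> 'I_N.+1}, (\sum_j y j == N)%N ->
     forall k, epoch p q (d * z k) (y k) != 0 /\ epoch p q (e * z k) (y k) != 0) ->
  (forall k, epoch p q (d * z k) N != 0 /\ epoch p q (e * z k) N != 0) ->
  (forall y : {ffun 'I_n -> 'I_N.+1}, (\sum_j y j == N)%N ->
     forall k, epoch p q (s / d * a k) (y k) != 0 /\ epoch p q (s / e * a k) (y k) != 0) ->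
  lattice_sum C p q n N z a b c d e N = prefactor C p q n z a d e N *
    lattice_sum C p q n N a z (s * b / (d * e)) (s * c / (d * e)) (s / d) (s / e) N.
Proof.
move=> z0 a0 b0 c0 d0 e0 bal sepz sepa qN den1 den2 den3.
have s0 : s != 0 by rewrite /s expfz_neq0.
have B0 : s * b / (d * e) != 0 by rewrite !mulf_neq0 ?invr_eq0 ?mulf_neq0.
have C0 : s * c / (d * e) != 0 by rewrite !mulf_neq0 ?invr_eq0 ?mulf_neq0.
have D0 : s / d != 0 by rewrite !mulf_neq0 ?invr_eq0.
have E0 : s / e != 0 by rewrite !mulf_neq0 ?invr_eq0.
have cvgid u : u * t @[t --> (1 : C)^'] --> u.
  by rewrite -[X in _ --> X]mulr1; apply: (@cvgMl_tmp C); exact: id1.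
have cvginv u : u / t @[t --> (1 : C)^'] --> u.
  by rewrite -[X in _ --> X]mulr1; apply: (@cvgMl_tmp C); exact: inv1.
have dn : Filter (1 : C)^' by typeclasses eauto.
have lhs := lattice_sum_cvg (FF := dn) _ p q hp q0 n N _ _ _ _ _ _ _ _ _ _ b0 c0 d0 e0
  (cvgid b) (cvginv c) (cvgid d) (cvginv e) z a N z0 den1.
have rhs1 := prefactor_cvg (FF := dn) _ p q hp q0 n _ _ _ _ _ _ d0 e0 (cvgid d) (cvginv e)
  z a N z0 a0 den2.
have rhs2 := lattice_sum_cvg (FF := dn) _ p q hp q0 n N _ _ _ _ _ _ _ _ _ _ B0 C0 D0 E0
  (cvgid _) (cvginv _) (cvginv _) (cvgid _) a z N a0 den3.
have rhs := @cvgM C _ _ dn _ _ _ _ rhs1 rhs2.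
apply: num_cvg_unique lhs _.
have ed0 : e / d != 0 by rewrite mulf_neq0 ?invr_eq0.
have near_b := near_regularM z b N.+1 z0 b0.
have near_B := near_regularM a _ N.+1 a0 B0.
have near_d := near_regularM z d N z0 d0.
have near_e := near_regularV z e N z0 e0.
have near_D := near_regularV a _ N a0 D0.
have near_E := near_regularM a _ N a0 E0.
have near_ed := near_ratio _ N ed0.
have dn' : Filter (nbhs (1 : C)^') by exact: dn.
have meet := @filterI C _ dn'.
have near_all := meet _ _ near_b (meet _ _ near_B (meet _ _ near_d (meet _ _ near_e
  (meet _ _ near_D (meet _ _ near_E (meet _ _ near_ed near0)))))).
suff eq_near : \forall t \near (1 : C)^',
    prefactor C p q n z a (d * t) (e / t) N * lattice_sum C p q n N a z
      (s * b / (d * e) * t) (s * c / (d * e) / t) (s / d / t) (s / e * t) N =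
    lattice_sum C p q n N z a (b * t) (c / t) (d * t) (e / t) N.
  by apply: cvg_trans rhs; exact: (near_eq_cvg eq_near).
refine (@filterS C _ dn' _ _ _ near_all) => t.
move=> [reg_b [reg_B [reg_d [reg_e [reg_D [reg_E [reg_ed t0]]]]]]].
have {}t0 : t != 0 by exact: t0.
have denE : d * t * (e / t) = d * e by field.
have BE : s * (b * t) / (d * t * (e / t)) = s * b / (d * e) * t.
  by rewrite denE; ring.
have CE : s * (c / t) / (d * t * (e / t)) = s * c / (d * e) / t.
  by rewrite denE; ring.
have DE : s / (d * t) = s / d / t by rewrite invfM mulrA.
have EE : s / (e / t) = s / e * t by rewrite invfM invrK mulrA.
have := transformation_generic _ p q (complex_theta_laws _ _ hp) q0 n N N z a
  (b * t) (c / t) (d * t) (e / t) (leqnn _) z0 a0.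
rewrite -/s BE CE DE EE denE !mulf_neq0 ?invr_eq0 // => h.
have edE : e / t / (d * t) = e / d / t / t by field; rewrite d0 t0.
have balt : d * e = \prod_k a k * (b * t) * (c / t) * \prod_k z k.
  by rewrite bal; field.
rewrite edE in h.
exact: esym (h isT isT isT isT balt sepz sepa qN reg_b reg_B reg_d reg_e reg_D reg_E reg_ed).
Qed.

End Transformation.

(** * The transformation in explicit form *)

Lemma series_term_mulrAC (K : numFieldType) (p q s : K) n (z a : 'I_n -> K) b c d e y :
  series_term K p q n a z (s * b / (d * e)) (s * c / (d * e)) (s / d) (s / e) y =
  Delta p (fun k => a k * q ^+ y k) / Delta p a
  * (\prod_(j < n) \prod_(k < n)
       (epoch p q (z j * a k) (y k) / epoch p q (q * a k / a j) (y k)))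
  * (\prod_(k < n)
       ((epoch p q (s * a k * b / (d * e)) (y k)
         * epoch p q (s * a k * c / (d * e)) (y k))
        / (epoch p q (s * a k / d) (y k) * epoch p q (s * a k / e) (y k)))).
Proof.
rewrite /series_term; congr (_ * _); apply: eq_bigr => k _.
by rewrite -!(mulrAC _ (a k)).
Qed.

Theorem corollary4p2 (R : realType) (p q : R[i])
  (hp : `|p| < 1) (hq : q != 0)
  (n N : nat) (hn : (1 <= n)%N)
  (z a : 'I_n -> R[i]) (b c d e : R[i])
  (hz : forall k, z k != 0) (ha : forall k, a k != 0)
  (hb : b != 0) (hc : c != 0) (hd : d != 0) (he : e != 0)
  (hbal : d * e = (\prod_(k < n) a k) * b * c * (\prod_(k < n) z k))
  (* no denominator on the left-hand side vanishes *)
  (hDz : Delta p z != 0)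
  (hqz : forall y : {ffun 'I_n -> 'I_N.+1}, sums_to y ->
     forall j k : 'I_n, epoch p q (q * z k / z j) (y k) != 0)
  (hdez : forall y : {ffun 'I_n -> 'I_N.+1}, sums_to y ->
     forall k : 'I_n, epoch p q (d * z k) (y k) != 0
                      /\ epoch p q (e * z k) (y k) != 0)
  (* no denominator on the right-hand side vanishes *)
  (hdezN : forall j : 'I_n, epoch p q (d * z j) N != 0
                            /\ epoch p q (e * z j) N != 0)
  (hDa : Delta p a != 0)
  (hqa : forall y : {ffun 'I_n -> 'I_N.+1}, sums_to y ->
     forall j k : 'I_n, epoch p q (q * a k / a j) (y k) != 0)
  (hdea : forall y : {ffun 'I_n -> 'I_N.+1}, sums_to y ->
     forall k : 'I_n, epoch p q (q ^ (1 - N%:Z) * a k / d) (y k) != 0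
                      /\ epoch p q (q ^ (1 - N%:Z) * a k / e) (y k) != 0) :
  \sum_(y : {ffun 'I_n -> 'I_N.+1} | sums_to y)
     (Delta p (fun k => z k * q ^+ y k) / Delta p z
      * (\prod_(j < n) \prod_(k < n)
           (epoch p q (a j * z k) (y k) / epoch p q (q * z k / z j) (y k)))
      * (\prod_(k < n)
           ((epoch p q (b * z k) (y k) * epoch p q (c * z k) (y k))
            / (epoch p q (d * z k) (y k) * epoch p q (e * z k) (y k)))))
  =
  (\prod_(j < n)
     (((a j * z j) ^+ N * epoch p q (d / a j) N * epoch p q (e / a j) N)
      / (epoch p q (d * z j) N * epoch p q (e * z j) N)))
  * \sum_(y : {ffun 'I_n -> 'I_N.+1} | sums_to y)
     (Delta p (fun k => a k * q ^+ y k) / Delta p a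
      * (\prod_(j < n) \prod_(k < n)
           (epoch p q (z j * a k) (y k) / epoch p q (q * a k / a j) (y k)))
      * (\prod_(k < n)
           ((epoch p q (q ^ (1 - N%:Z) * a k * b / (d * e)) (y k)
             * epoch p q (q ^ (1 - N%:Z) * a k * c / (d * e)) (y k))
            / (epoch p q (q ^ (1 - N%:Z) * a k / d) (y k)
               * epoch p q (q ^ (1 - N%:Z) * a k / e) (y k))))).
Proof.
have laws := complex_theta_laws R p hp.
(* The vector with all of [N] in position [k] brings in denominators of full length [N], from which
   separation up to [N] is read off. *)
pose single (k : 'I_n) : {ffun 'I_n -> 'I_N.+1} :=
  [ffun i => if i == k then ord_max else ord0].
have single_sum k : sums_to (single k).
  rewrite /sums_to (bigD1 k) //= ffunE eqxx big1 ?addn0 //= => i /negbTE ik.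
  by rewrite ffunE ik.
have single_k k : single k k = N :> nat by rewrite ffunE eqxx.
have sep (x : 'I_n -> R[i]) : (forall k, x k != 0) -> Delta p x != 0 ->
    (forall y : {ffun 'I_n -> 'I_N.+1}, sums_to y ->
       forall j k : 'I_n, epoch p q (q * x k / x j) (y k) != 0) ->
    theta_separated _ p q n x N.
  move=> x0 Dx qx [|m] j k mN /=.
    move=> jk; rewrite expr0 mul1r.
    have lt_jk (j' k' : 'I_n) : (j' < k')%N -> theta p (x k' / x j') != 0.
      move=> jk'; have /prodf_neq0/(_ j' isT)/prodf_neq0/(_ k' jk') := Dx.
      by rewrite mulf_eq0 negb_or => /andP[].
    have [jk'|kj|/val_inj jk'] := ltngtP j k; last by rewrite jk' eqxx in jk.
      rewrite (theta_divC _ _ laws) // mulf_neq0 ?lt_jk //.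
      by rewrite oppr_eq0 mulf_neq0 ?invr_eq0.
    exact: lt_jk.
  move=> _; have := qx _ (single_sum j) k j; rewrite single_k.
  move=> /epoch_neq0P /(_ m mN); congr (theta p _ != 0).
  by rewrite exprS; ring.
have sepz := sep z hz hDz hqz; have sepa := sep a ha hDa hqa.
(* Since [n >= 1] there is an index [k], and the ratio [z k / z k] is 1. *)
have qN m : (0 < m <= N)%N -> theta p (q ^+ m) != 0.
  move=> /andP[m0 mN]; pose k := Ordinal hn.
  by have := sepz m k k mN; rewrite m0 divff // mulr1 => /(_ isT).
have hbal' : d * e = \prod_k a k * b * c * \prod_k z k by [].
have den3 (y : {ffun 'I_n -> 'I_N.+1}) : (\sum_j y j == N)%N -> forall k,
    epoch p q (q ^ (1 - N%:Z) / d * a k) (y k) != 0 /\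
    epoch p q (q ^ (1 - N%:Z) / e * a k) (y k) != 0.
  by move=> yN k; have := hdea y yN k; rewrite !(mulrAC _ (a k)).
have main := transformation R p q hp hq n N z a b c d e hz ha hb hc hd he hbal'
  sepz sepa qN hdez hdezN den3.
apply: etrans main _; apply: (congr1 (fun t => prefactor _ p q n z a d e N * t)).
by apply: eq_bigr => y _; exact: series_term_mulrAC.
Qed.
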